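(* Let $\overline{M}\times_F\widetilde{N}$ be the warped product manifold of a $1$-dimensional manifold $(\overline{M},\overline{g})$, $\overline{g}_{11}=\pm1$, and a $3$-dimensional semi-Riemannian manifold $(\widetilde{N},\widetilde{g})$ (so $n=4$). If $(\widetilde{N},\widetilde{g})$ is not a space of constant curvature, then on ${\mathcal U}_C\subset\overline{M}\times_F\widetilde{N}$, for some function $L$ on ${\mathcal U}_C$, $$R\cdot R-Q(S,R)=L\,Q(g,C),$$ $$C\cdot R+R\cdot C=Q(S,C)+L\,Q(g,C)+C\cdot C-\frac1{(n-2)^2}\,Q\Big(g,\frac{n-2}2\,S\wedge S-\kappa\,g\wedge S+g\wedge S^2\Big).$$ Moreover, if $(\widetilde{N},\widetilde{g})$ is a quasi-Einstein manifold, then on ${\mathcal U}_S\cap{\mathcal U}_C\subset\overline{M}\times_F\widetilde{N}$, for some function $L_C$ on this set, $$C\cdot C=L_C\,Q(g,C),$$ $$C\cdot R+R\cdot C=Q(S,C)+(L+L_C)\,Q(g,C)-\frac1{(n-2)^2}\,Q\Big(g,\frac{n-2}2\,S\wedge S-\kappa\,g\wedge S+g\wedge S^2\Big).$$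
   Context: All manifolds are connected, paracompact and of class $C^\infty$. For a semi-Riemannian manifold $(M,g)$, $n=\dim M$, with Levi-Civita connection $\nabla$: ${\mathcal R}(X,Y)Z=\nabla_X\nabla_YZ-\nabla_Y\nabla_XZ-\nabla_{[X,Y]}Z$, $R(X_1,X_2,X_3,X_4)=g({\mathcal R}(X_1,X_2)X_3,X_4)$, $S(X,Y)=\mathrm{tr}\{Z\mapsto{\mathcal R}(Z,X)Y\}$, $g({\mathcal S}X,Y)=S(X,Y)$, $S^2(X,Y)=S({\mathcal S}X,Y)$, $\kappa=\mathrm{tr}\,{\mathcal S}$. For symmetric $(0,2)$-tensors $E,F$: $(E\wedge F)(X_1,X_2,X_3,X_4)=E(X_1,X_4)F(X_2,X_3)+E(X_2,X_3)F(X_1,X_4)-E(X_1,X_3)F(X_2,X_4)-E(X_2,X_4)F(X_1,X_3)$; $G=\frac12g\wedge g$; $C=R-\frac1{n-2}g\wedge S+\frac\kappa{(n-2)(n-1)}G$ is the Weyl tensor. For $B\in\{R,C\}$ define ${\mathcal B}$ by $g({\mathcal B}(X_1,X_2)X_3,X_4)=B(X_1,X_2,X_3,X_4)$; for a $(0,k)$-tensor $T$, $(B\cdot T)(X_1,\dots,X_k,X,Y)=-\sum_iT(X_1,\dots,{\mathcal B}(X,Y)X_i,\dots,X_k)$. For a symmetric $(0,2)$-tensor $A$, $(X\wedge_AY)Z=A(Y,Z)X-A(X,Z)Y$ and $Q(A,T)(X_1,\dots,X_k,X,Y)=-\sum_iT(X_1,\dots,(X\wedge_AY)X_i,\dots,X_k)$.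 ${\mathcal U}_S$ is the set of points where $S\ne\frac\kappa ng$; ${\mathcal U}_C$ is the set of points where $C\neq0$. A semi-Riemannian manifold $(M,g)$, $\dim M\ge3$, is quasi-Einstein if $\mathrm{rank}(S-\alpha g)=1$ on ${\mathcal U}_S$ for some function $\alpha$ on ${\mathcal U}_S$. Warped product: $F$ is a positive smooth function on $\overline M$ and $g=\pi_1^*\overline g+(F\circ\pi_1)\,\pi_2^*\widetilde g$ on $\overline M\times\widetilde N$. *)

(* Defs.v *)
From HB Require Import structures.
From mathcomp Require Import all_boot all_order all_algebra.
From mathcomp Require Import all_classical all_reals.
From mathcomp Require Import topology normedtype derive.
From mathcomp Require Import ring lra.

Set Implicit Arguments.
Unset Strict Implicit.
Unset Printing Implicit Defensive.

Import Order.TTheory GRing.Theory Num.Theory.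
Import numFieldNormedType.Exports.

Local Open Scope classical_set_scope.
Local Open Scope ring_scope.

(** * Algebra in one tangent space

    A tangent space is 'rV[R]_n, and a scalar product on it is given by its
    Gram matrix g : 'M[R]_n.  Tensors are curried functions; they are added
    and scaled pointwise. *)

Definition tensor2 (R : realType) (n : nat) : Type :=
  'rV[R]_n -> 'rV[R]_n -> R.
Definition tensor4 (R : realType) (n : nat) : Type :=
  'rV[R]_n -> 'rV[R]_n -> 'rV[R]_n -> 'rV[R]_n -> R.
Definition tensor6 (R : realType) (n : nat) : Type :=
  'rV[R]_n -> 'rV[R]_n -> tensor4 R n.

Definition inner (R : realType) (n : nat) (g : 'M[R]_n) : tensor2 R n :=
  fun u v => (u *m g *m v^T) 0 0.

(** The vector w such that g(w, v) = f v for all v, see [inner_sharp]. *)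
Definition sharp (R : realType) (n : nat) (g : 'M[R]_n) (f : 'rV[R]_n -> R) :
    'rV[R]_n :=
  (\row_k f (delta_mx 0 k)) *m invmx g.

Lemma inner_sharp (R : realType) (n : nat) (g : 'M[R]_n)
    (f : {scalar 'rV[R]_n}) (v : 'rV[R]_n) :
  g \in unitmx -> inner g (sharp g f) v = f v.
Proof.
move=> gU; rewrite /inner /sharp mulmxKV // !mxE [in RHS](row_sum_delta v).
rewrite linear_sum; apply: eq_bigr => k _.
by rewrite linearZ /= !mxE mulrC.
Qed.

Definition op_trace (R : realType) (n : nat) (f : 'rV[R]_n -> 'rV[R]_n) : R :=
  \tr (lin1_mx f).

Definition tensor2_mx (R : realType) (n : nat) (A : tensor2 R n) : 'M[R]_n :=
  \matrix_(i, j) A (delta_mx 0 i) (delta_mx 0 j).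

(** Kulkarni-Nomizu product *)
Definition kn (R : realType) (n : nat) (E F : tensor2 R n) : tensor4 R n :=
  fun X1 X2 X3 X4 => E X1 X4 * F X2 X3 + E X2 X3 * F X1 X4
                   - E X1 X3 * F X2 X4 - E X2 X4 * F X1 X3.

(** The (0,6)-tensor obtained when the endomorphisms D X Y act as derivations
    on a (0,4)-tensor. *)
Definition der_act (R : realType) (n : nat)
    (D : 'rV[R]_n -> 'rV[R]_n -> 'rV[R]_n -> 'rV[R]_n) (T : tensor4 R n) :
    tensor6 R n :=
  fun X1 X2 X3 X4 X Y =>
    - (T (D X Y X1) X2 X3 X4 + T X1 (D X Y X2) X3 X4
       + T X1 X2 (D X Y X3) X4 + T X1 X2 X3 (D X Y X4)).

(** B . T, where B acts through the endomorphisms g-dual to B X Y. *)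
Definition dot (R : realType) (n : nat) (g : 'M[R]_n) (B T : tensor4 R n) :
    tensor6 R n :=
  der_act (fun X Y Z => sharp g (B X Y Z)) T.

Definition Q (R : realType) (n : nat) (A : tensor2 R n) (T : tensor4 R n) :
    tensor6 R n :=
  der_act (fun X Y Z => A Y Z *: X - A X Z *: Y) T.

(** * Semi-Riemannian geometry on an open subset of R^n

    g x is the Gram matrix of the metric at x in the coordinate frame, and
    vector fields are functions 'rV[R]_n -> 'rV[R]_n. *)

Fixpoint Ck (R : realType) (n : nat) (V : normedModType R) (k : nat)
    (U : set 'rV[R]_n) (f : 'rV[R]_n -> V) : Prop :=
  (forall x, U x -> {for x, continuous f}) /\
  if k is k'.+1 then
    forall v, (forall x, U x -> derivable f x v) /\ Ck k' U (fun x => 'D_v f x)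
  else True.

Definition smooth_on (R : realType) (n : nat) (V : normedModType R)
    (U : set 'rV[R]_n) (f : 'rV[R]_n -> V) : Prop :=
  forall k, Ck k U f.

(** The Koszul formula on coordinate vector fields: Gamma^k_ij is the k-th
    component of [christoffel g x (delta_mx 0 i) (delta_mx 0 j)].  The
    lemmas [christoffelC] and [christoffel_metric] are the vanishing of the
    torsion and of the covariant derivative of g for [covD] below. *)
Definition christoffel (R : realType) (n : nat) (g : 'rV[R]_n -> 'M[R]_n)
    (x u v : 'rV[R]_n) : 'rV[R]_n :=
  sharp (g x) (fun w => 2^-1 * (inner ('D_u g x) v w + inner ('D_v g x) u w
                                - inner ('D_w g x) u v)).

Definition covD (R : realType) (n : nat) (g : 'rV[R]_n -> 'M[R]_n)
    (X Y : 'rV[R]_n -> 'rV[R]_n) : 'rV[R]_n -> 'rV[R]_n :=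
  fun x => 'D_(X x) Y x + christoffel g x (X x) (Y x).

Definition lie_bracket (R : realType) (n : nat) (X Y : 'rV[R]_n -> 'rV[R]_n) :
    'rV[R]_n -> 'rV[R]_n :=
  fun x => 'D_(X x) Y x - 'D_(Y x) X x.

Definition curvature (R : realType) (n : nat) (g : 'rV[R]_n -> 'M[R]_n)
    (X Y Z : 'rV[R]_n -> 'rV[R]_n) : 'rV[R]_n -> 'rV[R]_n :=
  fun x => covD g X (covD g Y Z) x - covD g Y (covD g X Z) x
           - covD g (lie_bracket X Y) Z x.

(** Tangent vectors at x are extended by constant fields; the value at x does
    not depend on the extension. *)
Definition curvature_at (R : realType) (n : nat) (g : 'rV[R]_n -> 'M[R]_n)
    (x u v w : 'rV[R]_n) : 'rV[R]_n :=
  curvature g (cst u) (cst v) (cst w) x.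

Lemma innerC (R : realType) (n : nat) (g : 'M[R]_n) (u v : 'rV[R]_n) :
  g^T = g -> inner g u v = inner g v u.
Proof.
move=> sg; have /(congr1 (fun A : 'M_1 => A 0 0)) : (v *m g *m u^T)^T = u *m g *m v^T.
  by rewrite !trmx_mul trmxK sg mulmxA.
by rewrite mxE.
Qed.

Lemma christoffelC (R : realType) (n : nat) (g : 'rV[R]_n -> 'M[R]_n)
    (x u v : 'rV[R]_n) :
  (forall w, ('D_w g x)^T = 'D_w g x) ->
  christoffel g x u v = christoffel g x v u.
Proof.
move=> sg; congr sharp; apply/funext => w; move: (sg w).
move: ('D_u g x) ('D_v g x) ('D_w g x) => A B D sD.
by rewrite (addrC (inner A v w)) (innerC u v sD).
Qed.

Lemma christoffel_metric (R : realType) (n : nat) (g : 'rV[R]_n -> 'M[R]_n)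
    (x u v w : 'rV[R]_n) :
  differentiable g x -> g x \in unitmx -> (g x)^T = g x ->
  (forall w, ('D_w g x)^T = 'D_w g x) ->
  inner (g x) (christoffel g x u v) w + inner (g x) v (christoffel g x u w)
    = inner ('D_u g x) v w.
Proof.
move=> dg gU sgx sg; rewrite [inner (g x) v _]innerC // /christoffel.
pose f (u v w : 'rV[R]_n) : R := 2^-1 * (inner ('D_u g x) v w
  + inner ('D_v g x) u w - inner ('D_w g x) u v).
have fP (u' v' w' : 'rV[R]_n) :
    inner (g x) (sharp (g x) (f u' v')) w' = f u' v' w'.
  have lf : scalar (f u' v').
    move=> a y z; rewrite /f.
    have -> : 'D_(a *: y + z) g x = a *: 'D_y g x + 'D_z g x.
      by rewrite !deriveE // linearP.
    move: ('D_u' g x) ('D_v' g x) ('D_y g x) ('D_z g x) => A B D E.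
    have vP (M : 'M[R]_n) t : inner M t (a *: y + z) = a * inner M t y + inner M t z.
      by rewrite /inner linearP mulmxDr -scalemxAr !mxE.
    have gP : inner (a *: D + E) u' v' = a * inner D u' v' + inner E u' v'.
      by rewrite /inner mulmxDr mulmxDl -scalemxAr -scalemxAl !mxE.
    by rewrite /GRing.scale /= !vP gP; ring.
  pose h := GRing.isLinear.Build R 'rV[R]_n R _ (f u' v') lf.
  exact: (inner_sharp (HB.pack (f u' v') h : {scalar 'rV[R]_n})).
rewrite !fP /f; move: (sg u) (sg v) (sg w).
move: ('D_u g x) ('D_v g x) ('D_w g x) => A B D sA _ _.
by rewrite (innerC w v sA); lra.
Qed.

Definition paracompact (T : topologicalType) : Prop :=
  forall U : set (set T), U `<=` open -> \bigcup_(A in U) A = setT ->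
  exists V : set (set T),
    [/\ V `<=` open, \bigcup_(A in V) A = setT,
        (forall B, V B -> exists2 A, U A & B `<=` A) &
        forall x : T, exists2 W, nbhs x W &
          finite_set [set B | V B /\ B `&` W !=set0]].

Record chart (R : realType) (n : nat) (T : Type) : Type := Chart {
  cdom : set T;
  ccoord : T -> 'rV[R]_n;
  cpoint : 'rV[R]_n -> T }.

Definition cimage (R : realType) (n : nat) (T : Type) (c : chart R n T) :
    set 'rV[R]_n :=
  ccoord c @` cdom c.

(** An atlas, the Gram matrices of a metric in the charts of the atlas, as
    functions of the coordinates, and a chart chosen around each point p, which
    identifies the tangent space at p with 'rV[R]_n.  Tensors at p are written
    in the frame of that chart; tensor equations do not depend on the choice.
    The axioms are in [semiriemannian]. *)
Record semiriem (R : realType) (n : nat) : Type := SemiRiem {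
  carrier :> topologicalType;
  index : Type;
  chart_of : index -> chart R n carrier;
  metric : index -> 'rV[R]_n -> 'M[R]_n;
  index_at : carrier -> index }.

Record semiriemannian (R : realType) (n : nat) (M : semiriem R n) : Prop := {
  sr_hausdorff : hausdorff_space M;
  sr_connected : connected [set: M];
  sr_paracompact : paracompact M;
  sr_index_at : forall p : M, cdom (chart_of (index_at p)) p;
  sr_open_dom : forall i : index M, open (cdom (chart_of i));
  sr_open_image : forall i : index M, open (cimage (chart_of i));
  sr_coordK : forall (i : index M) (p : M), cdom (chart_of i) p ->
    cpoint (chart_of i) (ccoord (chart_of i) p) = p;
  sr_cont_coord : forall i : index M,
    {within cdom (chart_of i), continuous (ccoord (chart_of i))};
  sr_cont_point : forall i : index M,
    {within cimage (chart_of i), continuous (cpoint (chart_of i))};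
  sr_transition : forall i j : index M,
    smooth_on (ccoord (chart_of i) @` (cdom (chart_of i) `&` cdom (chart_of j)))
              (ccoord (chart_of j) \o cpoint (chart_of i));
  sr_metric_smooth : forall i : index M,
    smooth_on (cimage (chart_of i)) (metric i);
  sr_metric_sym : forall (i : index M) x, cimage (chart_of i) x ->
    (metric i x)^T = metric i x;
  sr_metric_unit : forall (i : index M) x, cimage (chart_of i) x ->
    metric i x \in unitmx;
  sr_metric_change : forall (i j : index M) (p : M),
    cdom (chart_of i) p -> cdom (chart_of j) p ->
    let x := ccoord (chart_of i) p in
    let J := jacobian (ccoord (chart_of j) \o cpoint (chart_of i)) x in
    metric i x = J *m metric j (ccoord (chart_of j) p) *m J^T }.

Definition smooth_fun (R : realType) (n : nat) (M : semiriem R n)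
    (f : M -> R) : Prop :=
  forall i : index M,
    smooth_on (cimage (chart_of i)) (f \o cpoint (chart_of i)).

Arguments smooth_fun {R n} M f.

Definition coord_at (R : realType) (n : nat) (M : semiriem R n) (p : M) :
    'rV[R]_n :=
  ccoord (chart_of (index_at p)) p.

Definition gram (R : realType) (n : nat) (M : semiriem R n) (p : M) :
    'M[R]_n :=
  metric (index_at p) (coord_at p).

Definition gT (R : realType) (n : nat) (M : semiriem R n) (p : M) :
    tensor2 R n :=
  inner (gram p).

Definition Rop (R : realType) (n : nat) (M : semiriem R n) (p : M) :
    'rV[R]_n -> 'rV[R]_n -> 'rV[R]_n -> 'rV[R]_n :=
  curvature_at (metric (index_at p)) (coord_at p).

Definition RT (R : realType) (n : nat) (M : semiriem R n) (p : M) :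
    tensor4 R n :=
  fun X1 X2 X3 X4 => gT p (Rop p X1 X2 X3) X4.

Definition ST (R : realType) (n : nat) (M : semiriem R n) (p : M) :
    tensor2 R n :=
  fun X Y => op_trace (fun Z => Rop p Z X Y).

Definition Sop (R : realType) (n : nat) (M : semiriem R n) (p : M) :
    'rV[R]_n -> 'rV[R]_n :=
  fun X => sharp (gram p) (ST p X).

Definition S2T (R : realType) (n : nat) (M : semiriem R n) (p : M) :
    tensor2 R n :=
  fun X Y => ST p (Sop p X) Y.

Definition kappa (R : realType) (n : nat) (M : semiriem R n) (p : M) : R :=
  op_trace (Sop p).

Definition GT (R : realType) (n : nat) (M : semiriem R n) (p : M) :
    tensor4 R n :=
  2^-1 *: kn (gT p) (gT p).

Definition CT (R : realType) (n : nat) (M : semiriem R n) (p : M) :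
    tensor4 R n :=
  RT p - (n%:R - 2)^-1 *: kn (gT p) (ST p)
  + (kappa p / ((n%:R - 2) * (n%:R - 1))) *: GT p.

Definition U_S (R : realType) (n : nat) (M : semiriem R n) : set M :=
  [set p | ST p <> (kappa p / n%:R) *: gT p].

Definition U_C (R : realType) (n : nat) (M : semiriem R n) : set M :=
  [set p | CT p <> 0].

Arguments U_S {R n} M.
Arguments U_C {R n} M.

Definition constant_curvature (R : realType) (n : nat) (M : semiriem R n) :
    Prop :=
  exists c : R, forall p : M, RT p = c *: GT p.

Definition quasi_einstein (R : realType) (n : nat) (M : semiriem R n) : Prop :=
  (3 <= n)%N /\
  exists alpha : M -> R, forall p : M, U_S M p ->
    \rank (tensor2_mx (ST p - alpha p *: gT p)) = 1%N.

(** g_11 = 1 or g_11 = -1 in suitable coordinates around each point. *)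
Definition unit_metric (R : realType) (M : semiriem R 1) : Prop :=
  forall p : M, exists2 i : index M, cdom (chart_of i) p &
    exists2 e : R, e = 1 \/ e = -1 &
      forall x, cimage (chart_of i) x -> metric i x 0 0 = e.

Definition prod_chart (R : realType) (m n : nat) (S T : Type)
    (a : chart R m S) (b : chart R n T) : chart R (m + n) (S * T) :=
  Chart (cdom a `*` cdom b)
        (fun p => row_mx (ccoord a p.1) (ccoord b p.2))
        (fun x => (cpoint a (lsubmx x), cpoint b (rsubmx x))).

(** The coordinates x of B * N are those of B followed by those of N. *)
Definition warped (R : realType) (m n : nat) (B : semiriem R m)
    (N : semiriem R n) (F : B -> R) : semiriem R (m + n) :=
  @SemiRiem R (m + n) (B * N)%type (index B * index N)%type
    (fun i => prod_chart (chart_of i.1) (chart_of i.2))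
    (fun i x => block_mx (metric i.1 (lsubmx x)) 0 0
       (F (cpoint (chart_of i.1) (lsubmx x)) *: metric i.2 (rsubmx x)))
    (fun p => (index_at p.1, index_at p.2)).

Arguments warped {R m n} B N F.

(* Main.v *)
(** In the chart around p the metric is b dt^2 + f g, with g the metric of N.
    Write ^ for the Kulkarni-Nomizu product, T for dt^2 and H for f g.  The
    Christoffel symbols of the warped product have a closed form in terms of
    those of g, and so R is the sum of f times the curvature of g and of
    multiples of H ^ H and T ^ H.  In dimension three a curvature tensor is
    determined by its Ricci tensor, hence R = H ^ s + m H ^ H + l T ^ H, where s
    is the trace-free Ricci tensor of g, and C = 1/2 (H - b T) ^ s.  The same fact
    shows that 1/2 s ^ s + H ^ s^2 is a multiple of H ^ H.  Modulo this relation
    R.R - Q(S,R) + 2 (l/b) Q(g,C) = 0 is a polynomial identity.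

    Let k be the scalar curvature.  The tensor W = R - C = 1/2 g ^ S - k/12 g ^ g
    satisfies, in any dimension and for any k,
    W.W = Q(S,W) + 1/4 Q(g, S ^ S - k g ^ S + g ^ S^2), and the second identity is
    C.R + R.C = R.R + C.C - W.W.

    If N is quasi-Einstein then s = a H + c v v for a covector v, so that
    s^2 = 2 a^2 H - a s because s is trace-free, and C.C = -a/2 Q(g,C). *)

Require Import Defs.
From mathcomp Require Import all_boot all_order all_algebra.
From mathcomp Require Import all_classical all_reals.
From mathcomp Require Import topology normedtype derive.
From mathcomp Require Import ring lra.

Set Implicit Arguments.
Unset Strict Implicit.
Unset Printing Implicit Defensive.

Import Order.TTheory GRing.Theory Num.Theory.
Import numFieldNormedType.Exports.
Local Open Scope classical_set_scope.
Local Open Scope ring_scope.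

(** * Traces and sharps *)

(** The analytic half exists for one reason: the Ricci tensor determines the curvature of N in
    dimension three only once all its algebraic symmetries, pair symmetry included, are known. These
    rest on linearity of ['D_v] in [v] and on commuting second derivatives, whereas [smooth_on] only
    asserts that iterated directional derivatives exist and are continuous; both facts are therefore
    derived from the mean value theorem. The warped metric does not go through this again, since its
    curvature is computed from its Christoffel symbols in closed form. In one tangent space the
    inverse Gram matrix turns H and b T into complementary projections, with s living on the range
    of H. A short multiplication table then evaluates every contraction, and T ^ T = 0 because T has
    rank one. The relation between s ^ s and H ^ s^2 enters because R.R and Q(S,R) disagree in their
    terms quadratic in s. *)

Section Inner.
Context {R : realType} {n : nat}.
Implicit Types (M A : 'M[R]_n) (u v w : 'rV[R]_n) (a : R).

Lemma innerDl M u v w : inner M (u + v) w = inner M u w + inner M v w.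
Proof. by rewrite /inner !mulmxDl mxE. Qed.

Lemma innerZl M a u w : inner M (a *: u) w = a * inner M u w.
Proof. by rewrite /inner -!scalemxAl mxE. Qed.

Lemma innerNl M u w : inner M (- u) w = - inner M u w.
Proof. by rewrite -scaleN1r innerZl mulN1r. Qed.

Lemma innerBl M u v w : inner M (u - v) w = inner M u w - inner M v w.
Proof. by rewrite innerDl innerNl. Qed.

Lemma inner0l M w : inner M 0 w = 0.
Proof. by rewrite /inner !mul0mx mxE. Qed.

Lemma innerDr M u v w : inner M u (v + w) = inner M u v + inner M u w.
Proof. by rewrite /inner linearD mulmxDr mxE. Qed.

Lemma innerZr M a u w : inner M u (a *: w) = a * inner M u w.
Proof. by rewrite /inner linearZ /= -!scalemxAr mxE. Qed.

Lemma innerNr M u w : inner M u (- w) = - inner M u w.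
Proof. by rewrite -scaleN1r innerZr mulN1r. Qed.

Lemma innerBr M u v w : inner M u (v - w) = inner M u v - inner M u w.
Proof. by rewrite innerDr innerNr. Qed.

Lemma inner0r M w : inner M w 0 = 0.
Proof. by rewrite /inner trmx0 mulmx0 mxE. Qed.

Lemma inner_mxD M A u w : inner (M + A) u w = inner M u w + inner A u w.
Proof. by rewrite /inner mulmxDr mulmxDl mxE. Qed.

Lemma inner_mxZ a M u w : inner (a *: M) u w = a * inner M u w.
Proof. by rewrite /inner -scalemxAr -scalemxAl mxE. Qed.

Lemma inner_mxN M u w : inner (- M) u w = - inner M u w.
Proof. by rewrite -scaleN1r inner_mxZ mulN1r. Qed.

Lemma inner_mx0 u w : inner (0 : 'M[R]_n) u w = 0.
Proof. by rewrite /inner mulmx0 mul0mx mxE. Qed.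

Lemma inner_mulmxl M A u w : inner M (u *m A) w = inner (A *m M) u w.
Proof. by rewrite /inner mulmxA. Qed.

Lemma inner_delta M i j : inner M (delta_mx 0 i) (delta_mx 0 j) = M i j.
Proof. by rewrite /inner -rowE trmx_delta -colE !mxE. Qed.

Lemma inner_sum M u w :
  inner M u w = \sum_i \sum_j M i j * (u 0 i * w 0 j).
Proof.
rewrite /inner mxE exchange_big /=; apply: eq_bigr => j _.
rewrite mxE mulr_suml; apply: eq_bigr => i _.
by rewrite !mxE; ring.
Qed.

(** [sharp] reads [f] on basis vectors only; the hypothesis supplies the linearity of [f] along with
    its values. This is the usual way here to compute a sharp: exhibit the vector and check its
    pairings. *)
Lemma sharp_unique M (f : 'rV[R]_n -> R) u :
  M \in unitmx -> (forall w, inner M u w = f w) -> sharp M f = u.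
Proof.
move=> MU fE; rewrite /sharp; apply: (canLR (mulmxK MU)).
apply/rowP => k; rewrite !mxE -fE /inner trmx_delta -colE !mxE.
exact: eq_bigr.
Qed.

Lemma inner_inj M u v :
  M \in unitmx -> (forall w, inner M u w = inner M v w) -> u = v.
Proof. by move=> MU uv; rewrite -(sharp_unique MU uv) (sharp_unique (u := v)). Qed.

Lemma sharpD M (f h : 'rV[R]_n -> R) : sharp M (f + h) = sharp M f + sharp M h.
Proof. by rewrite /sharp -mulmxDl; congr mulmx; apply/rowP => k; rewrite !mxE. Qed.

Lemma sharpZ M a (f : 'rV[R]_n -> R) : sharp M (a *: f) = a *: sharp M f.
Proof.
by rewrite /sharp scalemxAl; congr mulmx; apply/rowP => k; rewrite !mxE.
Qed.

(** With row vectors, [X *m (E *m invmx g)] is the image of [X] under the endomorphism g-dual to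
    [E]. *)
Lemma sharp_kn (g E F : 'M[R]_n) (X Y Z : 'rV[R]_n) :
  g \in unitmx ->
  sharp g (kn (inner E) (inner F) X Y Z) =
    inner F Y Z *: (X *m (E *m invmx g)) + inner E Y Z *: (X *m (F *m invmx g))
    - inner E X Z *: (Y *m (F *m invmx g)) - inner F X Z *: (Y *m (E *m invmx g)).
Proof.
move=> gU; apply: sharp_unique => // w.
rewrite !(innerDl, innerNl, innerZl, inner_mulmxl) -!mulmxA mulVmx // !mulmx1.
by rewrite /kn; ring.
Qed.

End Inner.

Section Trace.
Context {R : realType} {n : nat}.
Implicit Types (u v : 'rV[R]_n) (f h : 'rV[R]_n -> 'rV[R]_n).

Lemma op_traceE f : op_trace f = \sum_i f (delta_mx 0 i) 0 i.
Proof. by rewrite /op_trace /mxtrace; apply: eq_bigr => i _; rewrite mxE. Qed.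

Lemma op_traceD f h : op_trace (fun X => f X + h X) = op_trace f + op_trace h.
Proof. by rewrite !op_traceE -big_split; apply: eq_bigr => i _; rewrite mxE. Qed.

Lemma op_traceN f : op_trace (fun X => - f X) = - op_trace f.
Proof. by rewrite !op_traceE -sumrN; apply: eq_bigr => i _; rewrite mxE. Qed.

Lemma op_traceZ a f : op_trace (fun X => a *: f X) = a * op_trace f.
Proof. by rewrite !op_traceE mulr_sumr; apply: eq_bigr => i _; rewrite mxE. Qed.

Lemma op_trace_mulmx (A : 'M[R]_n) : op_trace (fun X => X *m A) = \tr A.
Proof.
by rewrite op_traceE; apply: eq_bigr => i _; rewrite -rowE mxE.
Qed.

Lemma op_trace_inner (M : 'M[R]_n) u v :
  op_trace (fun X => inner M X u *: v) = inner M v u.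
Proof.
rewrite op_traceE [in RHS](row_sum_delta v) /inner !mulmx_suml summxE.
by apply: eq_bigr => i _; rewrite -!scalemxAl !mxE mulrC.
Qed.

End Trace.

(** Contraction of the first and last slots by the inverse Gram matrix, see [ricciE]. It is defined
    for an arbitrary tensor so that it applies to curvature tensors, to Kulkarni-Nomizu products and
    to their differences. *)
Definition ricci (R : realType) (n : nat) (g : 'M[R]_n) (T : tensor4 R n) :
    tensor2 R n :=
  fun Y Z => op_trace (fun X => sharp g (T X Y Z)).

Section Ricci.
Context {R : realType} {n : nat} (g : 'M[R]_n).
Hypothesis gU : g \in unitmx.

Lemma ricciD (T U : tensor4 R n) : ricci g (T + U) = ricci g T + ricci g U.
Proof.
apply/funext => Y; apply/funext => Z; rewrite /ricci -[RHS]op_traceD.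
by congr op_trace; apply/funext => X; rewrite -sharpD.
Qed.

Lemma ricciZ a (T : tensor4 R n) : ricci g (a *: T) = a *: ricci g T.
Proof.
apply/funext => Y; apply/funext => Z; rewrite /ricci -[RHS]op_traceZ.
by congr op_trace; apply/funext => X; rewrite -sharpZ.
Qed.

(** In [sharp_kn] the terms with [X] outside the scalar contribute the trace of an endomorphism;
    those with [X] inside it have rank one and are traced by [op_trace_inner]. *)
Lemma ricci_kn (E F : 'M[R]_n) Y Z :
  ricci g (kn (inner E) (inner F)) Y Z =
    \tr (E *m invmx g) * inner F Y Z + \tr (F *m invmx g) * inner E Y Z
    - inner (F *m invmx g *m E) Y Z - inner (E *m invmx g *m F) Y Z.
Proof.
rewrite /ricci.
under eq_fun do rewrite sharp_kn //.
do !(rewrite op_traceD || rewrite op_traceN || rewrite op_traceZ).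
rewrite !op_trace_mulmx !op_trace_inner !inner_mulmxl.
by rewrite (mulrC (inner F Y Z)) (mulrC (inner E Y Z)).
Qed.

End Ricci.

(** * Polynomial identities for tensors *)

Ltac inner_expand :=
  rewrite ?(innerDl, innerNl, innerZl, innerDr, innerNr, innerZr,
            inner_mxD, inner_mxZ, inner_mulmxl).

(** Values of a symmetric form are brought to a fixed order of arguments, so that [ring] and [field]
    see equal values as the same atom; [inner_generalize] then makes each value a variable. *)
Ltac inner_orient u v sM := rewrite ?(innerC v u sM).

Ltac inner_orient6 X1 X2 X3 X4 X Y sM :=
  inner_orient X1 X2 sM; inner_orient X1 X3 sM; inner_orient X1 X4 sM;
  inner_orient X1 X sM; inner_orient X1 Y sM; inner_orient X2 X3 sM;
  inner_orient X2 X4 sM; inner_orient X2 X sM; inner_orient X2 Y sM;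
  inner_orient X3 X4 sM; inner_orient X3 X sM; inner_orient X3 Y sM;
  inner_orient X4 X sM; inner_orient X4 Y sM; inner_orient X Y sM.

Ltac inner_generalize :=
  repeat match goal with
  | |- context [inner ?M ?u ?v] => generalize (inner M u v); intro
  end.

Section Pointwise.
Context {R : realType} {n : nat}.
Implicit Types (T U : tensor4 R n) (V W : tensor6 R n).

Lemma tensor4D T U a b c d : (T + U) a b c d = T a b c d + U a b c d.
Proof. by []. Qed.
Lemma tensor4N T a b c d : (- T) a b c d = - T a b c d.
Proof. by []. Qed.
Lemma tensor4Z k T a b c d : (k *: T) a b c d = k * T a b c d.
Proof. by []. Qed.
Lemma tensor6D V W a b c d x y :
  (V + W) a b c d x y = V a b c d x y + W a b c d x y.
Proof. by []. Qed.
Lemma tensor6N V a b c d x y : (- V) a b c d x y = - V a b c d x y.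
Proof. by []. Qed.
Lemma tensor6Z k V a b c d x y : (k *: V) a b c d x y = k * V a b c d x y.
Proof. by []. Qed.

End Pointwise.

Lemma inner_wedgel (R : realType) (n : nat) (M : 'M[R]_n) a b u v w :
  inner M (a *: u - b *: v) w = a * inner M u w - b * inner M v w.
Proof. by rewrite innerBl !innerZl. Qed.

Lemma inner_wedger (R : realType) (n : nat) (M : 'M[R]_n) a b u v w :
  inner M w (a *: u - b *: v) = a * inner M w u - b * inner M w v.
Proof. by rewrite innerBr !innerZr. Qed.

Section Generic.
Context {R : realType} {n : nat} (g S : 'M[R]_n).
Hypotheses (gU : g \in unitmx) (sg : g^T = g) (sS : S^T = S).

(** Here [k] stands for a twelfth of the scalar curvature, whence the factor [12 * k]. The form [S2]
    arises when [S] is paired with the endomorphism dual to [S]; in the values of [g], [S] and [S2]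
    on six vectors the claim is a polynomial identity. *)
Lemma dot_ricci_part (k : R) :
  let S2 := S *m invmx g *m S in
  let W := 2^-1 *: kn (inner g) (inner S) - k *: kn (inner g) (inner g) in
  dot g W W = Q (inner S) W
    + 4^-1 *: Q (inner g) (kn (inner S) (inner S)
         - (12 * k) *: kn (inner g) (inner S) + kn (inner g) (inner S2)).
Proof.
move=> S2 W.
have sS2 : S2^T = S2.
  by rewrite /S2 !trmx_mul sS trmx_inv sg mulmxA.
have Sgg : S *m invmx g *m g = S by rewrite mulmxKV.
pose D X Y Z := sharp g (W X Y Z).
have DE X Y Z : D X Y Z =
    (2^-1 * inner S Y Z - 2 * k * inner g Y Z) *: X
    + (2^-1 * inner g Y Z) *: (X *m (S *m invmx g))
    - (2^-1 * inner S X Z - 2 * k * inner g X Z) *: Y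
    - (2^-1 * inner g X Z) *: (Y *m (S *m invmx g)).
  apply: sharp_unique => // w; inner_expand; rewrite Sgg.
  by rewrite /W ?(tensor4D, tensor4N, tensor4Z) /kn; field.
rewrite /dot -/D.
have Dg X Y Z w : inner g (D X Y Z) w =
    (2^-1 * inner S Y Z - 2 * k * inner g Y Z) * inner g X w
    + (2^-1 * inner g Y Z) * inner S X w
    - (2^-1 * inner S X Z - 2 * k * inner g X Z) * inner g Y w
    - (2^-1 * inner g X Z) * inner S Y w.
  by rewrite DE; inner_expand; rewrite Sgg.
have DS X Y Z w : inner S (D X Y Z) w =
    (2^-1 * inner S Y Z - 2 * k * inner g Y Z) * inner S X w
    + (2^-1 * inner g Y Z) * inner S2 X w
    - (2^-1 * inner S X Z - 2 * k * inner g X Z) * inner S Y w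
    - (2^-1 * inner g X Z) * inner S2 Y w.
  by rewrite DE; inner_expand.
(* [W] is built from [g] and [S], so the action of [D] is known once its pairings with these two
   forms are. *)
move: D DE Dg DS => D _ Dg DS.
apply/funext => X1; apply/funext => X2; apply/funext => X3; apply/funext => X4.
apply/funext => X; apply/funext => Y.
rewrite ?(tensor6D, tensor6N, tensor6Z) /Q /der_act /W.
rewrite  ?(tensor4D, tensor4N, tensor4Z) /kn.
rewrite ?(innerC _ (D _ _ _) sg) ?(innerC _ (D _ _ _) sS) !Dg !DS.
rewrite !inner_wedgel !inner_wedger.
inner_orient6 X1 X2 X3 X4 X Y sg.
inner_orient6 X1 X2 X3 X4 X Y sS.
inner_orient6 X1 X2 X3 X4 X Y sS2.
inner_generalize.
by field.
Qed.

End Generic.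

(** [Q A] of a vanishing tensor is zero, so a known tensor relation may be added as a correction
    term. This replaces the search for the instances of the relation to substitute in a large
    polynomial goal. *)
Lemma eq_addQ (R : realType) (n : nat) (A : tensor2 R n) (K L : tensor4 R n)
    (V W : tensor6 R n) :
  K = L -> V = W + Q A (K - L) -> V = W.
Proof.
move=> -> ->; apply/funext => X1; apply/funext => X2; apply/funext => X3.
apply/funext => X4; apply/funext => X; apply/funext => Y.
by rewrite tensor6D /Q /der_act subrr /= !addr0 oppr0 addr0.
Qed.

(** * Algebra of the curvature of a warped product in one tangent space *)

Section WarpedAlgebra.
Context {R : realType} {n : nat} (g H T s : 'M[R]_n) (t : 'rV[R]_n -> R).
Context (b m l : R).
Let gi := invmx g.
Let q := s *m gi *m s.
Hypotheses (gU : g \in unitmx) (b0 : b != 0) (gE : g = b *: T + H).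
Hypotheses (sH : H^T = H) (ss : s^T = s) (sT : T^T = T).
Hypothesis TE : forall u v, inner T u v = t u * t v.
Hypotheses (HgH : H *m gi *m H = H) (Hgs : H *m gi *m s = s).
Hypotheses (sgH : s *m gi *m H = s) (TgT : T *m gi *m T = b^-1 *: T).
Hypotheses (TgH : T *m gi *m H = 0) (HgT : H *m gi *m T = 0).
Hypotheses (Tgs : T *m gi *m s = 0) (sgT : s *m gi *m T = 0).

Let RR : tensor4 R n :=
  kn (inner H) (inner s) + m *: kn (inner H) (inner H)
  + l *: kn (inner T) (inner H).
Let S := s + (4 * m + l / b) *: H + (3 * l) *: T.
Let C : tensor4 R n := 2^-1 *: kn (inner (H - b *: T)) (inner s).

Let sq : q^T = q.
Proof.
have sg : g^T = g by rewrite gE linearD linearZ /= sT sH.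
by rewrite /q !trmx_mul /gi trmx_inv sg ss mulmxA.
Qed.

Let gE' u v : inner g u v = b * inner T u v + inner H u v.
Proof. by rewrite gE inner_mxD inner_mxZ. Qed.

Let SE u v :
  inner S u v = inner s u v + (4 * m + l / b) * inner H u v + 3 * l * inner T u v.
Proof. by rewrite /S !inner_mxD !inner_mxZ. Qed.

Let JE u v : inner (H - b *: T) u v = inner H u v - b * inner T u v.
Proof. by rewrite inner_mxD inner_mxN inner_mxZ. Qed.

(** By the multiplication table the three terms of [RR] contract to [s], [4 H] and [H / b + 3 T];
    this is where the coefficients of [S] come from. *)
Lemma ricci_warped :
  \tr (H *m gi) = 3 -> \tr (T *m gi) = b^-1 -> \tr (s *m gi) = 0 ->
  ricci g RR = inner S.
Proof.
move=> trH trT trs; rewrite /RR 2!ricciD !ricciZ.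
apply/funext => Y; apply/funext => Z.
transitivity (ricci g (kn (inner H) (inner s)) Y Z
  + m * ricci g (kn (inner H) (inner H)) Y Z
  + l * ricci g (kn (inner T) (inner H)) Y Z) => //.
rewrite !ricci_kn // -/gi trH trT trs HgH Hgs sgH HgT TgH !inner_mx0 SE.
by inner_generalize; field.
Qed.

Lemma trace_warped :
  \tr (H *m gi) = 3 -> \tr (T *m gi) = b^-1 -> \tr (s *m gi) = 0 ->
  \tr (S *m gi) = 12 * m + 6 * (l / b).
Proof.
move=> trH trT trs; rewrite /S !mulmxDl -!scalemxAl !linearD !linearZ /=.
by rewrite trH trT trs; field.
Qed.

(** [T ^ T] vanishes by [TE], and the [H ^ H] and [T ^ H] terms of the curvature, Ricci and scalar
    parts cancel. What survives is [H ^ s] minus half of [(b T + H) ^ s]. The denominator [2 * 3] is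
    (n-2)(n-1). *)
Lemma weyl_warped :
  RR - 2^-1 *: kn (inner g) (inner S)
    + ((12 * m + 6 * (l / b)) / (2 * 3)) *: (2^-1 *: kn (inner g) (inner g)) = C.
Proof.
apply/funext => X1; apply/funext => X2; apply/funext => X3; apply/funext => X4.
rewrite /RR /C ?(tensor4D, tensor4N, tensor4Z) /kn /S gE.
rewrite ?(inner_mxD, inner_mxN, inner_mxZ) !TE.
inner_generalize.
by field.
Qed.

Lemma dot_R_R rho :
  2^-1 *: kn (inner s) (inner s) + kn (inner H) (inner q)
    = rho *: kn (inner H) (inner H) ->
  dot g RR RR - Q (inner S) RR = (- 2 * (l / b)) *: Q (inner g) C.
Proof.
move=> K0.
pose D X Y Z := sharp g (RR X Y Z).
(* One formula for the pairing of [D X Y Z] with an arbitrary form [M]; for [M] equal to [H], [T] or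
   [s] the multiplication table leaves only [H], [T], [s] and [q]. *)
have DE M X Y Z w : inner M (D X Y Z) w =
    (inner s Y Z + 2 * m * inner H Y Z + l * inner T Y Z) * inner (H *m gi *m M) X w
    - (inner s X Z + 2 * m * inner H X Z + l * inner T X Z) * inner (H *m gi *m M) Y w
    + inner H Y Z * inner (s *m gi *m M) X w
    - inner H X Z * inner (s *m gi *m M) Y w
    + l * (inner H Y Z * inner (T *m gi *m M) X w
           - inner H X Z * inner (T *m gi *m M) Y w).
  rewrite /D /RR -[(_ + _) X Y Z]/(kn (inner H) (inner s) X Y Z
     + m *: kn (inner H) (inner H) X Y Z + l *: kn (inner T) (inner H) X Y Z).
  rewrite 2!sharpD !sharpZ !sharp_kn // -/gi.
  by inner_expand; ring.
have DH X Y Z w := DE H X Y Z w.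
have DT X Y Z w := DE T X Y Z w.
have Ds X Y Z w := DE s X Y Z w.
move: DH DT Ds; rewrite HgH sgH TgH HgT sgT TgT Hgs Tgs -/q {DE}.
rewrite /dot -/D; move: D => D DH DT Ds.
(* Without K0 the two sides differ by Q (inner H) of the difference in K0. *)
apply: (@eq_addQ _ _ (inner H) _ _ _ _ K0).
have RE X1 X2 X3 X4 : RR X1 X2 X3 X4 = kn (inner H) (inner s) X1 X2 X3 X4
    + m * kn (inner H) (inner H) X1 X2 X3 X4 + l * kn (inner T) (inner H) X1 X2 X3 X4 by [].
have CE X1 X2 X3 X4 :
  C X1 X2 X3 X4 = 2^-1 * kn (inner (H - b *: T)) (inner s) X1 X2 X3 X4 by [].
set K := (X in Q (inner H) X).
have KE X1 X2 X3 X4 : K X1 X2 X3 X4 = 2^-1 * kn (inner s) (inner s) X1 X2 X3 X4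
    + kn (inner H) (inner q) X1 X2 X3 X4 - rho * kn (inner H) (inner H) X1 X2 X3 X4 by [].
move: RE CE KE; generalize K RR C => K' R' C' RE CE KE.
apply/funext => X1; apply/funext => X2; apply/funext => X3; apply/funext => X4.
apply/funext => X; apply/funext => Y.
rewrite tensor6D tensor6N tensor6D !tensor6Z /Q /der_act !RE !CE !KE /kn !JE.
rewrite ?(innerC _ (D _ _ _) sH) ?(innerC _ (D _ _ _) ss)
 ?(innerC _ (D _ _ _) sT) !DH !DT !Ds.
rewrite !inner_wedgel !inner_wedger !SE !gE' ?inner_mxZ ?inner_mx0 !TE.
inner_orient6 X1 X2 X3 X4 X Y sH.
inner_orient6 X1 X2 X3 X4 X Y ss.
inner_orient6 X1 X2 X3 X4 X Y sq.
inner_generalize.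
by field.
Qed.

(** The eigenvalues of a trace-free [s] of this shape are [al], [al], [- 2 al] when the covector is
    not null, which explains the quadratic relation for [q]. Writing [V] as a product of covectors
    builds [V ^ V = 0] into the final polynomial identity. *)
Lemma dot_C_C al c (V : 'M[R]_n) (v : 'rV[R]_n -> R) :
  (forall u w, inner V u w = v u * v w) -> s = al *: H + c *: V ->
  q = (2 * al ^+ 2) *: H - al *: s ->
  dot g C C = (- (al / 2)) *: Q (inner g) C.
Proof.
move=> VE sE qE.
have sE' u w : inner s u w = al * inner H u w + c * inner V u w.
  by rewrite sE inner_mxD !inner_mxZ.
have qE' u w : inner q u w = 2 * al ^+ 2 * inner H u w - al * inner s u w.
  by rewrite qE inner_mxD inner_mxN !inner_mxZ.
pose D X Y Z := sharp g (C X Y Z).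
have DE M X Y Z w : inner M (D X Y Z) w = 2^-1 * (
    inner s Y Z * inner (H *m gi *m M) X w - inner s X Z * inner (H *m gi *m M) Y w
    - b * (inner s Y Z * inner (T *m gi *m M) X w - inner s X Z * inner (T *m gi *m M) Y w)
    + (inner H Y Z - b * inner T Y Z) * inner (s *m gi *m M) X w
    - (inner H X Z - b * inner T X Z) * inner (s *m gi *m M) Y w).
  rewrite /D /C -[(_ *: _) X Y Z]/(2^-1 *: kn (inner (H - b *: T)) (inner s) X Y Z).
  rewrite !sharpZ !sharp_kn // -/gi.
  rewrite mulmxBl -scalemxAl mulmxBr -scalemxAr !mulmxBr -!scalemxAr.
  inner_expand; rewrite ?(inner_mxD, inner_mxN, inner_mxZ).
  by ring.
have DH X Y Z w := DE H X Y Z w.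
have DT X Y Z w := DE T X Y Z w.
have Ds X Y Z w := DE s X Y Z w.
move: DH DT Ds; rewrite HgH sgH TgH HgT sgT TgT Hgs Tgs -/q {DE}.
rewrite /dot -/D; move: D => D DH DT Ds.
have CE X1 X2 X3 X4 :
  C X1 X2 X3 X4 = 2^-1 * kn (inner (H - b *: T)) (inner s) X1 X2 X3 X4 by [].
move: CE; generalize C => C' CE.
apply/funext => X1; apply/funext => X2; apply/funext => X3; apply/funext => X4.
apply/funext => X; apply/funext => Y.
rewrite tensor6Z /Q /der_act !CE /kn !JE.
rewrite ?(innerC _ (D _ _ _) sH) ?(innerC _ (D _ _ _) ss)
   ?(innerC _ (D _ _ _) sT) !DH !DT !Ds.
rewrite !inner_wedgel !inner_wedger !qE' !sE' !gE' ?inner_mxN ?inner_mxZ ?inner_mx0 !TE !VE.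
inner_orient6 X1 X2 X3 X4 X Y sH.
inner_generalize.
by field.
Qed.

End WarpedAlgebra.

(** * Curvature tensors in dimension three *)

(** Linearity is required in the last slot alone: the symmetries carry it to the other three. *)
Record curvature_like (R : realType) (n : nat) (T : tensor4 R n) : Prop := {
  curv12 : forall X Y Z W, T X Y Z W = - T Y X Z W;
  curv34 : forall X Y Z W, T X Y Z W = - T X Y W Z;
  curv_bianchi : forall X Y Z W, T X Y Z W + T Y Z X W + T Z X Y W = 0;
  curv_linear : forall X Y Z a U V, T X Y Z (a *: U + V) = a * T X Y Z U + T X Y Z V }.

Section CurvatureLike.
Context {R : realType} {n : nat}.
Implicit Types (T U : tensor4 R n) (X Y Z W : 'rV[R]_n).

(** The octahedron argument: the Bianchi identities for the four cyclic shifts of the arguments are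
    combined by means of the two antisymmetries. *)
Lemma curv_pair T X Y Z W : curvature_like T -> T X Y Z W = T Z W X Y.
Proof.
move=> cT.
have := curv_bianchi cT X Y Z W; have := curv_bianchi cT Y Z W X.
have := curv_bianchi cT Z W X Y; have := curv_bianchi cT W X Y Z.
have := curv12 cT Z X Y W; have := curv34 cT Y Z W X.
have := curv34 cT Z W Y X; have := curv12 cT W Y Z X.
have := curv34 cT Y W Z X; have := curv12 cT W X Z Y.
have := curv34 cT X W Z Y; have := curv34 cT X Z W Y.
have := curv12 cT W X Y Z; have := curv34 cT X Y W Z.
lra.
Qed.

Lemma curvature_likeD T U :
  curvature_like T -> curvature_like U -> curvature_like (T + U).
Proof.
move=> cT cU; split=> [X Y Z W|X Y Z W|X Y Z W|X Y Z a V W]; rewrite !tensor4D.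
- by rewrite (curv12 cT) (curv12 cU) opprD.
- by rewrite (curv34 cT) (curv34 cU) opprD.
- by have := curv_bianchi cT X Y Z W; have := curv_bianchi cU X Y Z W; lra.
- by rewrite (curv_linear cT) (curv_linear cU); ring.
Qed.

Lemma curvature_likeZ k T : curvature_like T -> curvature_like (k *: T).
Proof.
move=> cT; split=> [X Y Z W|X Y Z W|X Y Z W|X Y Z a V W]; rewrite !tensor4Z.
- by rewrite (curv12 cT) mulrN.
- by rewrite (curv34 cT) mulrN.
- by rewrite -!mulrDr (curv_bianchi cT) mulr0.
- by rewrite (curv_linear cT); ring.
Qed.

Lemma curvature_like_kn (E F : 'M[R]_n) : E^T = E -> F^T = F ->
  curvature_like (kn (inner E) (inner F)).
Proof.
move=> sE sF; split=> [X Y Z W|X Y Z W|X Y Z W|X Y Z a V W]; rewrite /kn.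
- by ring.
- by ring.
- rewrite (innerC Y X sE) (innerC Y X sF) (innerC Z X sE) (innerC Z X sF).
  by rewrite (innerC Z Y sE) (innerC Z Y sF); ring.
- by rewrite !innerDr !innerZr; ring.
Qed.

Lemma linear_eq0 (f : 'rV[R]_n -> R) :
  (forall a u v, f (a *: u + v) = a * f u + f v) ->
  (forall i, f (delta_mx 0 i) = 0) -> forall v, f v = 0.
Proof.
move=> lf f0 v; have f00 : f 0 = 0.
  by have := lf 1 0 0; rewrite scaler0 addr0 mul1r => /eqP; rewrite -subr_eq0
     opprD addrA subrr sub0r oppr_eq0 => /eqP.
rewrite (row_sum_delta v); elim/big_ind: _ => // [u w fu fw|i _].
  by rewrite -[u]scale1r lf fu fw mulr0 addr0.
by rewrite -[_ *: _]addr0 lf f0 f00 mulr0 addr0.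
Qed.

(** Each argument in turn is moved to the last slot, where linearity is available, and is there
    reduced to basis vectors. *)
Lemma curvature_like_eq0 T : curvature_like T ->
  (forall i j k l, T (delta_mx 0 i) (delta_mx 0 j) (delta_mx 0 k) (delta_mx 0 l) = 0) ->
  T = 0.
Proof.
move=> cT T0; apply/funext => X; apply/funext => Y; apply/funext => Z.
apply/funext; apply: linear_eq0 => [a u v|l]; first exact: curv_linear.
rewrite (curv34 cT); apply/eqP; rewrite oppr_eq0; apply/eqP; move: Z.
apply: linear_eq0 => [a u v|k]; first exact: curv_linear.
rewrite (curv_pair _ _ _ _ cT); move: Y; apply: linear_eq0 => [a u v|j].
  exact: curv_linear.
rewrite (curv34 cT); apply/eqP; rewrite oppr_eq0; apply/eqP; move: X.
apply: linear_eq0 => [a u v|i]; first exact: curv_linear.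
exact: T0.
Qed.

Lemma ricciE (g : 'M[R]_n) T Y Z :
  ricci g T Y Z = \sum_i \sum_k T (delta_mx 0 i) Y Z (delta_mx 0 k) * invmx g k i.
Proof.
rewrite /ricci op_traceE; apply: eq_bigr => i _.
by rewrite mxE; apply: eq_bigr => k _; rewrite mxE.
Qed.

End CurvatureLike.

Section DimensionThree.
Context {R : realType}.

Let o0 : 'I_3 := @Ordinal 3 0 isT.
Let o1 : 'I_3 := @Ordinal 3 1 isT.
Let o2 : 'I_3 := @Ordinal 3 2 isT.

Let sum3 (F : 'I_3 -> R) : \sum_i F i = F o0 + F o1 + F o2.
Proof.
rewrite !big_ord_recl big_ord0 addr0 addrA.
by congr (F _ + F _ + F _); apply: val_inj.
Qed.

Let ord3 (P : 'I_3 -> Prop) : P o0 -> P o1 -> P o2 -> forall i, P i.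
Proof.
move=> P0 P1 P2 [[|[|[|i]]] lti] //.
- by rewrite (_ : Ordinal lti = o0) //; apply: val_inj.
- by rewrite (_ : Ordinal lti = o1) //; apply: val_inj.
- by rewrite (_ : Ordinal lti = o2) //; apply: val_inj.
Qed.

Let det3 (h : 'M[R]_3) : \det h =
  h o0 o0 * (h o1 o1 * h o2 o2 - h o1 o2 * h o2 o1)
  - h o0 o1 * (h o1 o0 * h o2 o2 - h o1 o2 * h o2 o0)
  + h o0 o2 * (h o1 o0 * h o2 o1 - h o1 o1 * h o2 o0).
Proof.
have det2 (A : 'M[R]_2) : \det A = A 0 0 * A 1 1 - A 0 1 * A 1 0.
  rewrite (expand_det_row _ 0) !big_ord_recl big_ord0 /cofactor !det_mx11 !mxE.
  have -> : lift 0 0 = 1 :> 'I_2 by apply: val_inj.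
  have -> : lift 1 0 = 0 :> 'I_2 by apply: val_inj.
  by rewrite /=; ring.
rewrite (expand_det_row _ o0) sum3 /cofactor !det2 !mxE.
have -> : lift o0 0 = o1 by apply: val_inj.
have -> : lift o0 1 = o2 by apply: val_inj.
have -> : lift o1 0 = o0 by apply: val_inj.
have -> : lift o1 1 = o2 by apply: val_inj.
have -> : lift o2 0 = o0 by apply: val_inj.
have -> : lift o2 1 = o1 by apply: val_inj.
by rewrite /=; ring.
Qed.

(** Six independent curvature components face six Ricci equations. The system is inverted explicitly
    for an arbitrary Gram matrix, without passing to an orthonormal frame; the inverse metric [h] is
    used because it is what the equations contain. *)
Lemma ricci_flat3 (g : 'M[R]_3) (T : tensor4 R 3) : g \in unitmx -> g^T = g ->
  curvature_like T -> ricci g T = 0 -> T = 0.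
Proof.
move=> gU sg cT Ric0.
pose h := invmx g.
have sh : h^T = h by rewrite /h trmx_inv sg.
have hs i j : h i j = h j i by rewrite -[in LHS]sh mxE.
have h0 : \det h != 0 by rewrite det_inv invr_eq0 -unitfE.
pose t i j k l := T (delta_mx 0 i) (delta_mx 0 j) (delta_mx 0 k) (delta_mx 0 l).
have t12 i j k l : t i j k l = - t j i k l by exact: curv12.
have t34 i j k l : t i j k l = - t i j l k by exact: curv34.
have tp i j k l : t i j k l = t k l i j by exact: curv_pair.
have t11 i k l : t i i k l = 0 by have := t12 i i k l; lra.
have t33 i j k : t i j k k = 0 by have := t34 i j k k; lra.
have ric j k : \sum_i \sum_l t i j k l * h l i = 0.
  by rewrite -[LHS](ricciE g T (delta_mx 0 j) (delta_mx 0 k)) Ric0.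
have t10 i j : t i j o1 o0 = - t i j o0 o1 by [].
have t20 i j : t i j o2 o0 = - t i j o0 o2 by [].
have t21 i j : t i j o2 o1 = - t i j o1 o2 by [].
(* Rewriting rules that reduce every component to the six with index pairs among 01, 02, 12, the
   smaller pair first; a repeated index within a pair gives zero. *)
pose tE := (t11, t33, t12 o1 o0, t12 o2 o0, t12 o2 o1, t10, t20, t21,
  tp o0 o2 o0 o1, tp o1 o2 o0 o1, tp o1 o2 o0 o2).
pose hE := (hs o1 o0, hs o2 o0, hs o2 o1).
have r00 := ric o0 o0; have r01 := ric o0 o1; have r02 := ric o0 o2.
have r11 := ric o1 o1; have r12 := ric o1 o2; have r22 := ric o2 o2.
rewrite !sum3 !tE !hE in r00 r01 r02 r11 r12 r22.
move: h0; rewrite det3 !hE => h0.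
set a00 := h o0 o0 in h0 r00 r01 r02 r11 r12 r22.
set a01 := h o0 o1 in h0 r00 r01 r02 r11 r12 r22.
set a02 := h o0 o2 in h0 r00 r01 r02 r11 r12 r22.
set a11 := h o1 o1 in h0 r00 r01 r02 r11 r12 r22.
set a12 := h o1 o2 in h0 r00 r01 r02 r11 r12 r22.
set a22 := h o2 o2 in h0 r00 r01 r02 r11 r12 r22.
(* The left-hand sides are named as Ricci components: they can be unfolded to verify the inversion
   formula and then replaced by zero. *)
set e00 := (X in X = 0) in r00; set e01 := (X in X = 0) in r01.
set e02 := (X in X = 0) in r02; set e11 := (X in X = 0) in r11.
set e12 := (X in X = 0) in r12; set e22 := (X in X = 0) in r22.
pose k := 2^-1 * (a00 * e00 + a11 * e11 + a22 * e22 + 2 * (a01 * e01 + a02 * e02 + a12 * e12)).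
pose b00 := a11 * a22 - a12 ^+ 2; pose b11 := a00 * a22 - a02 ^+ 2.
pose b22 := a00 * a11 - a01 ^+ 2; pose b01 := a02 * a12 - a01 * a22.
pose b02 := a01 * a12 - a02 * a11; pose b12 := a01 * a02 - a00 * a12.
have k0 : k = 0 by rewrite /k r00 r01 r02 r11 r12 r22; ring.
(* The right-hand sides are the components of g ^ Ric - k/2 g ^ g, multiplied by
   the determinant of h; here k is half of the scalar curvature and the b's are
   the entries of the adjugate of h, that is, of the determinant times g. *)
have T0101 : t o0 o1 o0 o1 = 0.
  apply: (mulfI h0); transitivity
    (- (b00 * e11 + b11 * e00 - 2 * b01 * e01 - k * a22)).
    by rewrite /k /e00 /e01 /e02 /e11 /e12 /e22 /b00 /b01 /b02 /b11 /b12 /b22; field.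
  by rewrite ?(r00, r01, r02, r11, r12, r22) k0; ring.
have T0202 : t o0 o2 o0 o2 = 0.
  apply: (mulfI h0); transitivity
    (- (b00 * e22 + b22 * e00 - 2 * b02 * e02 - k * a11)).
    by rewrite /k /e00 /e01 /e02 /e11 /e12 /e22 /b00 /b01 /b02 /b11 /b12 /b22; field.
  by rewrite ?(r00, r01, r02, r11, r12, r22) k0; ring.
have T1212 : t o1 o2 o1 o2 = 0.
  apply: (mulfI h0); transitivity
    (- (b11 * e22 + b22 * e11 - 2 * b12 * e12 - k * a00)).
    by rewrite /k /e00 /e01 /e02 /e11 /e12 /e22 /b00 /b01 /b02 /b11 /b12 /b22; field.
  by rewrite ?(r00, r01, r02, r11, r12, r22) k0; ring.
have T0102 : t o0 o1 o0 o2 = 0.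
  apply: (mulfI h0); transitivity
    (- (b00 * e12 + b12 * e00 - b02 * e01 - b01 * e02 + k * a12)).
    by rewrite /k /e00 /e01 /e02 /e11 /e12 /e22 /b00 /b01 /b02 /b11 /b12 /b22; field.
  by rewrite ?(r00, r01, r02, r11, r12, r22) k0; ring.
have T0112 : t o0 o1 o1 o2 = 0.
  apply: (mulfI h0); transitivity
    (- (b01 * e12 + b12 * e01 - b02 * e11 - b11 * e02 - k * a02)).
    by rewrite /k /e00 /e01 /e02 /e11 /e12 /e22 /b00 /b01 /b02 /b11 /b12 /b22; field.
  by rewrite ?(r00, r01, r02, r11, r12, r22) k0; ring.
have T0212 : t o0 o2 o1 o2 = 0.
  apply: (mulfI h0); transitivity
    (- (b01 * e22 + b22 * e01 - b02 * e12 - b12 * e02 + k * a01)).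
    by rewrite /k /e00 /e01 /e02 /e11 /e12 /e22 /b00 /b01 /b02 /b11 /b12 /b22; field.
  by rewrite ?(r00, r01, r02, r11, r12, r22) k0; ring.
apply: curvature_like_eq0 => // i j k' l; rewrite -/(t i j k' l).
have T0 := (T0101, T0202, T1212, T0102, T0112, T0212, oppr0).
by move: i j k' l; do 4![apply: ord3]; rewrite ?tE ?T0.
Qed.

(** Both sides of the last equation have the same Ricci tensor, so [ricci_flat3] applies to their
    difference: [g ^ s] contracts to [s] because [s] is trace-free, and [g ^ g] to [4 g], which
    turns [k / 3] into [k / 12]. *)
Lemma ricci_decomposition3 (g : 'M[R]_3) (T : tensor4 R 3) :
    g \in unitmx -> g^T = g -> curvature_like T ->
  let P := tensor2_mx (ricci g T) in
  let k := \tr (P *m invmx g) in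
  let s := P - (k / 3) *: g in
  [/\ ricci g T = inner P, s^T = s, \tr (s *m invmx g) = 0 &
      T = kn (inner g) (inner s) + (k / 12) *: kn (inner g) (inner g)].
Proof.
move=> gU sg cT P k s.
have PE : ricci g T = inner P.
  apply/funext => Y; apply/funext => Z; apply/esym/eqP; rewrite -subr_eq0; apply/eqP.
  move: Z; apply: linear_eq0 => [a u v|j].
    rewrite innerDr innerZr !ricciE.
    have -> : \sum_i \sum_k T (delta_mx 0 i) Y (a *: u + v) (delta_mx 0 k) * invmx g k i =
      a * (\sum_i \sum_k T (delta_mx 0 i) Y u (delta_mx 0 k) * invmx g k i) +
       \sum_i \sum_k T (delta_mx 0 i) Y v (delta_mx 0 k) * invmx g k i.
      rewrite mulr_sumr -big_split; apply: eq_bigr => i _ /=.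
      rewrite mulr_sumr -big_split; apply: eq_bigr => l _ /=.
      by rewrite !(curv34 cT _ Y _ (delta_mx 0 l)) curv_linear //; ring.
    by ring.
  move: Y; apply: linear_eq0 => [a u v|i].
    rewrite innerDl innerZl !ricciE.
    have -> : \sum_i \sum_k T (delta_mx 0 i) (a *: u + v) (delta_mx 0 j) (delta_mx 0 k)
        * invmx g k i =
      a * (\sum_i \sum_k T (delta_mx 0 i) u (delta_mx 0 j) (delta_mx 0 k) * invmx g k i) +
       \sum_i \sum_k T (delta_mx 0 i) v (delta_mx 0 j) (delta_mx 0 k) * invmx g k i.
      rewrite mulr_sumr -big_split; apply: eq_bigr => i _ /=.
      rewrite mulr_sumr -big_split; apply: eq_bigr => l _ /=.
      by rewrite !(curv_pair _ _ (delta_mx 0 j) _ cT) curv_linear //; ring.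
    by ring.
  by rewrite inner_delta mxE subrr.
have sP : P^T = P.
  apply/matrixP => i j; rewrite !mxE !ricciE exchange_big; apply: eq_bigr => a _ /=.
  apply: eq_bigr => c _ /=.
  rewrite (curv_pair _ _ _ _ cT) (curv12 cT) (curv34 cT) opprK; congr (_ * _).
  by rewrite -[in LHS]sg -trmx_inv mxE.
have ss : s^T = s by rewrite /s linearB linearZ /= sg sP.
have trg : \tr (g *m invmx g) = 3 by rewrite mulmxV // mxtrace1.
have trs : \tr (s *m invmx g) = 0.
  by rewrite mulmxBl -scalemxAl linearB linearZ /= trg -/k divfK ?subrr // pnatr_eq0.
split=> //; apply/eqP; rewrite -subr_eq0; apply/eqP.
apply: (ricci_flat3 gU) => //.
  rewrite -scaleN1r; apply: curvature_likeD => //; apply: curvature_likeZ.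
  apply: curvature_likeD; last apply: curvature_likeZ; exact: curvature_like_kn.
rewrite -scaleN1r ricciD ricciZ ricciD ricciZ.
apply/funext => Y; apply/funext => Z.
rewrite !fctE !ricci_kn // trg trs mulmxKV // mulmxV // !mul1mx PE.
rewrite /s !inner_mxD inner_mxN inner_mxZ /GRing.scale /= [RHS](_ : _ = 0) //; by field.
Qed.

(** Half of [s ^ s] contracts to [- q] and [g ^ q] to [q] plus its trace times [g]. The sum
    contracts to a multiple of [g], as does [g ^ g], and the difference is a Ricci-flat curvature
    tensor. *)
Lemma tracefree_square3 (g s : 'M[R]_3) :
    g \in unitmx -> g^T = g -> s^T = s -> \tr (s *m invmx g) = 0 ->
  let q := s *m invmx g *m s in
  2^-1 *: kn (inner s) (inner s) + kn (inner g) (inner q)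
    = (\tr (q *m invmx g) / 4) *: kn (inner g) (inner g).
Proof.
move=> gU sg ss trs q.
have sq : q^T = q by rewrite /q !trmx_mul trmx_inv sg ss mulmxA.
have trg : \tr (g *m invmx g) = 3 by rewrite mulmxV // mxtrace1.
apply/eqP; rewrite -subr_eq0; apply/eqP; apply: (ricci_flat3 gU) => //.
  rewrite -scaleN1r; apply: curvature_likeD; last do 2!apply: curvature_likeZ.
    apply: curvature_likeD; first apply: curvature_likeZ; exact: curvature_like_kn.
  exact: curvature_like_kn.
rewrite -scaleN1r 2!ricciD !ricciZ.
apply/funext => Y; apply/funext => Z.
rewrite !fctE !ricci_kn // trg trs !mulmxKV // ?mulmxV // ?mul1mx -/q.
rewrite /GRing.scale /= [RHS](_ : _ = 0) //; by field.
Qed.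

End DimensionThree.

(** * Directional derivatives *)

Section Lines.
Context {R : realType} {V : normedModType R}.

Lemma is_derive_line (W : normedModType R) (f : V -> W) (x v : V) (s : R) d :
  is_derive (x + s *: v) v f d -> is_derive s 1 (fun r : R => f (x + r *: v)) d.
Proof.
move=> [df <-].
have E : (fun h : R => h^-1 *: (((fun r : R => f (x + r *: v)) \o shift s) (h *: 1)
            - f (x + s *: v)))
    = (fun h => h^-1 *: ((f \o shift (x + s *: v)) (h *: v) - f (x + s *: v))).
  apply/funext => h /=; congr (_ *: (f _ - _)).
  by rewrite [h *: 1]mulr1 scalerDl addrCA.
by split; [rewrite /derivable E|rewrite /derive E].
Qed.

Lemma is_derive_shift_arg (W : normedModType R) (f : V -> W) (x a v : V) d :
  is_derive (x + a) v f d -> is_derive x v (fun y => f (y + a)) d.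
Proof.
move=> [df <-].
have E : (fun h : R => h^-1 *: (((fun y => f (y + a)) \o shift x) (h *: v)
            - f (x + a)))
    = (fun h => h^-1 *: ((f \o shift (x + a)) (h *: v) - f (x + a))).
  by apply/funext => h /=; rewrite addrA.
by split; [rewrite /derivable E|rewrite /derive E].
Qed.

(** The increment [h] is replaced by [c * h] in the difference quotient. The case [c = 0] is
    separate, because this substitution must preserve punctured neighbourhoods of zero. *)
Lemma is_deriveZdir (W : normedModType R) (f : V -> W) (x v : V) (c : R) d :
  is_derive x v f d -> is_derive x (c *: v) f (c *: d).
Proof.
move=> fd; have [->|c0] := eqVneq c 0; first by rewrite !scale0r; exact: is_derive0.
have fl : ((fun h => h^-1 *: ((f \o shift x) (h *: v) - f x)) @ 0^' --> d)%classic.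
  by case: fd => df <-.
have cl : ((fun h : R => c * h) @ 0^' --> (0 : R)^')%classic.
  move=> A [e /= e0 eA]; exists (e / `|c|); first by rewrite /= divr_gt0 ?normr_gt0.
  move=> h /=; rewrite !sub0r !normrN => he h0; apply: eA => /=; last first.
    by rewrite mulf_neq0.
  by rewrite sub0r normrN normrM mulrC -ltr_pdivlMr ?normr_gt0.
pose q h := h^-1 *: ((f \o shift x) (h *: v) - f x).
have cq : ((q \o (fun h : R => c * h)) @ 0^' --> d)%classic := cvg_comp _ _ cl fl.
have := cvgZl_tmp (k := c) cq.
have -> : c \*: (q \o (fun h : R => c * h))
  = (fun h => h^-1 *: ((f \o shift x) (h *: (c *: v)) - f x)).
  apply/funext => h; change (c *: q (c * h) = h^-1 *: (f (h *: (c *: v) + x) - f x)).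
  rewrite /q /= !scalerA [h * c]mulrC.
  have [->|h0] := eqVneq h 0; first by rewrite mulr0 !invr0 mulr0 !scale0r.
  by rewrite invfM mulrA divff // mul1r.
move=> lim; split; first by apply/cvg_ex; eexists; exact: lim.
by apply: cvg_lim; [exact: norm_hausdorff|exact: lim].
Qed.

Lemma mvt_line (f : V -> R) (df : R -> R) (y w : V) :
  (forall s : R, 0 <= s <= 1 -> is_derive (y + s *: w) w f (df s)) ->
  exists2 c, 0 <= c <= 1 & f (y + w) - f y = df c.
Proof.
move=> fd; have fl (s : R) : 0 <= s <= 1 ->
    is_derive s 1 (fun r => f (y + r *: w)) (df s).
  by move=> /fd; exact: is_derive_line.
have [||c] := @MVT R (fun r => f (y + r *: w)) df 0 1 ltr01.
- move=> s; rewrite in_itv /= => /andP[s0 s1]; apply: fl.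
  by rewrite !ltW.
- apply: derivable_within_continuous => s; rewrite in_itv /= => /fl sd.
  exact: ex_derive.
rewrite in_itv /= => /andP[c0 c1]; rewrite scale1r scale0r addr0 subr0 mulr1 => E.
by exists c; rewrite ?ltW.
Qed.

(** The direction of differentiation stays [w] while the step is [h *: w], so that one derivative
    function serves all [h] of either sign. *)
Lemma mvt_line_scaled (f df : V -> R) (y w : V) (h : R) :
  (forall s : R, 0 <= s <= 1 -> is_derive (y + (s * h) *: w) w f (df (y + (s * h) *: w))) ->
  exists2 c, 0 <= c <= 1 & f (y + h *: w) - f y = h * df (y + (c * h) *: w).
Proof.
move=> fd.
have [s s01|c c01 E] := @mvt_line f (fun s => h * df (y + (s * h) *: w)) y (h *: w).
  by apply: is_deriveZdir; rewrite scalerA; exact: fd.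
by exists c.
Qed.

Lemma nbhs_parallelogram (A : set V) (x u v : V) : nbhs x A ->
  exists2 d : R, 0 < d &
    forall a b : R, `|a| <= d -> `|b| <= d -> A (x + a *: u + b *: v).
Proof.
move=> /nbhs_ballP[r /= r0 rA].
(* The summand 1 makes [k] positive even for zero vectors and makes the final estimate strict. *)
pose k := `|u| + `|v| + 1.
have k0 : 0 < k by rewrite ltr_wpDl // addr_ge0.
exists (r / k); first by rewrite divr_gt0.
move=> a b ad bd; apply: rA; rewrite -ball_normE /ball_ /=.
rewrite -addrA opprD addrA subrr add0r normrN.
rewrite (le_lt_trans (ler_normD _ _)) // !normrZ.
apply: (@le_lt_trans _ _ (r / k * (`|u| + `|v|))).
  by rewrite mulrDr lerD // ler_wpM2r.
by rewrite -mulrA gtr_pMr // mulrC ltr_pdivrMr // mul1r /k ltrDl.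
Qed.

(** The step along [u + v] is split into one along [u] and one along [v] starting at [x + h *: u].
    The mean value theorem turns the second quotient into a value of [fv] at a point tending to [x],
    where [fv] is continuous. *)
Lemma is_deriveD_dir (f fv : V -> R) (x u v : V) (a : R) :
  is_derive x u f a -> (\forall y \near x, is_derive y v f (fv y)) ->
  {for x, continuous fv} -> is_derive x (u + v) f (a + fv x).
Proof.
move=> [fu <-] fvd cfv.
have lu : ((fun h => h^-1 *: ((f \o shift x) (h *: u) - f x)) @ 0^' --> 'D_u f x)%classic.
  by [].
pose q (h : R) := h^-1 *: (f (x + h *: u + h *: v) - f (x + h *: u)).
have lq : (q @ 0^' --> fv x)%classic.
  apply/cvgrPdist_lt => e e0.
  have : \forall y \near x, is_derive y v f (fv y) /\ `|fv x - fv y| < e.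
    by apply: filterI => //; move/cvgrPdist_lt: cfv; exact.
  move=> /(nbhs_parallelogram u v)[d d0 dA].
  near=> h.
  have h0 : h != 0 by near: h; exact: nbhs_dnbhs_neq.
  have hd : `|h| <= d.
    by apply: ltW; near: h; exact: dnbhs0_lt.
  have hs (s : R) : 0 <= s <= 1 -> `|s * h| <= d.
    move=> /andP[s0 s1]; rewrite normrM ger0_norm //.
    by apply: le_trans hd; rewrite ler_piMl.
  have [s s01|c c01 E] := @mvt_line_scaled f fv (x + h *: u) v h.
    by have [] := dA h (s * h) hd (hs s s01).
  rewrite /q E [_ *: _]mulKf //.
  by have [] := dA h (c * h) hd (hs c c01).
have := cvgD lu lq.
have -> : (fun h => h^-1 *: ((f \o shift x) (h *: u) - f x)) + q =
    (fun h => h^-1 *: ((f \o shift x) (h *: (u + v)) - f x)).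
  apply/funext => h; rewrite fctE /q /= -scalerDr; congr (_ *: _).
  rewrite [h *: u + x]addrC scalerDr [h *: u + h *: v + x]addrC [x + (_ + _)]addrA.
  by rewrite [LHS]addrC [LHS]addrA subrK.
move=> lim; split; first by apply/cvg_ex; eexists; exact: lim.
by apply: cvg_lim; [exact: norm_hausdorff|exact: lim].
Unshelve. all: by end_near. Qed.

(** The second difference of [f] over a small parallelogram is, by two mean value steps in either
    order, [d ^+ 2] times a value of [fuv] and [d ^+ 2] times a value of [fvu], both taken near [x].
    Continuity makes these values close to those at [x]. *)
Lemma schwarz (f fu fv fuv fvu : V -> R) (x u v : V) :
  (\forall y \near x, is_derive y u f (fu y)) ->
  (\forall y \near x, is_derive y v f (fv y)) ->
  (\forall y \near x, is_derive y v fu (fuv y)) ->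
  (\forall y \near x, is_derive y u fv (fvu y)) ->
  {for x, continuous fuv} -> {for x, continuous fvu} -> fuv x = fvu x.
Proof.
move=> dfu dfv dfuv dfvu cuv cvu.
apply/eqP; rewrite -subr_eq0 -normr_le0; apply/ler_addgt0Pl => e e0.
rewrite addr0.
have e20 : 0 < e / 2 by rewrite divr_gt0.
have : \forall y \near x, [/\ is_derive y u f (fu y), is_derive y v f (fv y),
    is_derive y v fu (fuv y), is_derive y u fv (fvu y) &
    `|fuv x - fuv y| < e / 2 /\ `|fvu x - fvu y| < e / 2].
  near=> y; split; [by near: y|by near: y|by near: y|by near: y|split].
    by near: y; move/cvgrPdist_lt: cuv; exact.
  by near: y; move/cvgrPdist_lt: cvu; exact.
move=> /(nbhs_parallelogram u v)[d d0 dA].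
have hd : `|d| <= d by rewrite gtr0_norm.
have hs (s : R) : 0 <= s <= 1 -> `|s * d| <= d.
  move=> /andP[s0 s1]; rewrite normrM ger0_norm //.
  by apply: le_trans hd; rewrite ler_piMl.
have z0 : `|0 : R| <= d by rewrite normr0 ltW.
pose Delta := f (x + d *: u + d *: v) - f (x + d *: u) - (f (x + d *: v) - f x).
have [a [b [ad bd E1]]] : exists a b, [/\ `|a| <= d, `|b| <= d &
    Delta = d * (d * fuv (x + a *: u + b *: v))].
  have [s s01|c c01 E] := @mvt_line_scaled (fun y => f (y + d *: v) - f y)
      (fun y => fu (y + d *: v) - fu y) x u d.
    apply: is_deriveB; last first.
      by have [] := dA (s * d) 0 (hs s s01) z0; rewrite scale0r addr0.
    apply: is_derive_shift_arg.
    by have [] := dA (s * d) d (hs s s01) hd.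
  have [s s01|c' c01' E'] := @mvt_line_scaled fu fuv (x + (c * d) *: u) v d.
    by have [] := dA (c * d) (s * d) (hs c c01) (hs s s01).
  exists (c * d), (c' * d); split; [exact: hs|exact: hs|].
  by rewrite /Delta E E'.
have [a' [b' [ad' bd' E2]]] : exists a b, [/\ `|a| <= d, `|b| <= d &
    Delta = d * (d * fvu (x + a *: u + b *: v))].
  have [s s01|c c01 E] := @mvt_line_scaled (fun y => f (y + d *: u) - f y)
      (fun y => fv (y + d *: u) - fv y) x v d.
    apply: is_deriveB; last first.
      by have [] := dA 0 (s * d) z0 (hs s s01); rewrite scale0r addr0.
    apply: is_derive_shift_arg.
    by have [] := dA d (s * d) hd (hs s s01); rewrite addrAC.
  have [s s01|c' c01' E'] := @mvt_line_scaled fv fvu (x + (c * d) *: v) u d.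
    by have [] := dA (s * d) (c * d) (hs s s01) (hs c c01); rewrite addrAC.
  exists (c' * d), (c * d); split; [exact: hs|exact: hs|].
  rewrite /Delta [x + (c' * d) *: u + _]addrAC -E' -E [x + d *: v + _]addrAC.
  by rewrite !opprB addrACA [RHS]addrACA; ring.
have E12 : fuv (x + a *: u + b *: v) = fvu (x + a' *: u + b' *: v).
  have d'0 : d != 0 by rewrite gt_eqF.
  by apply: (mulfI d'0); apply: (mulfI d'0); rewrite -E1 E2.
have [_ _ _ _ [n1 _]] := dA a b ad bd; have [_ _ _ _ [_ n2]] := dA a' b' ad' bd'.
move: n1 n2; rewrite E12.
set p := fvu (x + _ + _); move=> n1 n2.
rewrite (_ : _ - _ = (fuv x - p) - (fvu x - p)); last by ring.
by rewrite (le_trans (ler_normB _ _)) // [e]splitr lerD // ltW.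
Unshelve. all: by end_near. Qed.

End Lines.

(** * Derivatives of matrix products and inverses *)

Section MatrixDerivative.
Context {R : realType} {V : normedModType R}.

Lemma is_derive_mul (f h : V -> R) (x v : V) df dh :
  is_derive x v f df -> is_derive x v h dh ->
  is_derive x v (fun y => f y * h y) (df * h x + f x * dh).
Proof.
by move=> fd hd; have := is_deriveM fd hd; rewrite addrC [_ *: df]mulrC.
Qed.

Lemma is_derive_add (W : normedModType R) (f h : V -> W) (x v : V) df dh :
  is_derive x v f df -> is_derive x v h dh ->
  is_derive x v (fun y => f y + h y) (df + dh).
Proof. exact: is_deriveD. Qed.

Lemma derivable_mul (f h : V -> R) (x v : V) :
  derivable f x v -> derivable h x v -> derivable (fun y => f y * h y) x v.
Proof. exact: derivableM. Qed.

Lemma is_derive_mxP (m n : nat) (f : V -> 'M[R]_(m, n)) (x v : V) d :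
  is_derive x v f d <-> forall i j, is_derive x v (fun y => f y i j) (d i j).
Proof.
split=> [[df <-] i j|fd].
  split; first by move/derivable_mxP: df.
  by rewrite derive_mx // mxE.
have df : derivable f x v.
  by apply/derivable_mxP => i j; have [] := fd i j.
split => //; rewrite derive_mx //; apply/matrixP => i j; rewrite mxE.
by have [_ ->] := fd i j.
Qed.

Lemma is_derive_bigsum (I : Type) (r : seq I) (h dh : I -> V -> R) (x v : V) :
  (forall i, is_derive x v (h i) (dh i x)) ->
  is_derive x v (fun y => \sum_(i <- r) h i y) (\sum_(i <- r) dh i x).
Proof.
move=> hd; elim: r => [|i r IH].
  under eq_fun do rewrite big_nil; rewrite big_nil; exact: is_derive_cst.
under eq_fun do rewrite big_cons; rewrite big_cons.
exact: is_derive_add.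
Qed.

Lemma is_derive_mulmx (m n p : nat) (A : V -> 'M[R]_(m, n)) (B : V -> 'M[R]_(n, p))
    (x v : V) dA dB :
  is_derive x v A dA -> is_derive x v B dB ->
  is_derive x v (fun y => A y *m B y) (dA *m B x + A x *m dB).
Proof.
move=> /is_derive_mxP Ad /is_derive_mxP Bd; apply/is_derive_mxP => i j.
under eq_fun do rewrite mxE.
rewrite !mxE -big_split /=.
apply: (@is_derive_bigsum _ _ (fun k y => A y i k * B y k j)
          (fun k _ => dA i k * B x k j + A x i k * dB k j)) => k.
exact: is_derive_mul.
Qed.

Lemma derivable_bigprod (I : Type) (r : seq I) (h : I -> V -> R) (x v : V) :
  (forall i, derivable (h i) x v) -> derivable (fun y => \prod_(i <- r) h i y) x v.
Proof.
move=> hd; elim: r => [|i r IH].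
  under eq_fun do rewrite big_nil; exact: derivable_cst.
by under eq_fun do rewrite big_cons; exact: derivable_mul.
Qed.

Lemma derivable_bigsum (I : Type) (r : seq I) (h : I -> V -> R) (x v : V) :
  (forall i, derivable (h i) x v) -> derivable (fun y => \sum_(i <- r) h i y) x v.
Proof.
move=> hd; apply: ex_derive.
by apply: (@is_derive_bigsum _ _ _ (fun i y => 'D_v (h i) y)) => i; exact: derivableP.
Qed.

Lemma derivable_det (n : nat) (A : V -> 'M[R]_n) (x v : V) :
  derivable A x v -> derivable (fun y => \det (A y)) x v.
Proof.
move=> /derivable_mxP dA; apply: derivable_bigsum => s.
by apply: derivable_mul; [exact: derivable_cst|exact: derivable_bigprod].
Qed.

Lemma derivable_adj (n : nat) (A : V -> 'M[R]_n) (x v : V) :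
  derivable A x v -> derivable (fun y => \adj (A y)) x v.
Proof.
move=> dA; apply/derivable_mxP => i j; under eq_fun do rewrite mxE /cofactor.
apply: derivable_mul; first exact: derivable_cst.
apply: derivable_det; apply/derivable_mxP => k l.
under eq_fun do rewrite !mxE.
by move/derivable_mxP: dA => dA; exact: dA.
Qed.

(** Cramer's rule makes the entries of the inverse quotients of polynomials. [invmx] agrees with
    that formula only at invertible matrices, hence the condition on a neighbourhood. *)
Lemma derivable_invmx (n : nat) (A : V -> 'M[R]_n) (x v : V) :
  (\forall y \near x, A y \in unitmx) -> derivable A x v ->
  derivable (fun y => invmx (A y)) x v.
Proof.
move=> AU dA.
apply: (@near_eq_derivable _ _ _ (fun y => (\det (A y))^-1 *: \adj (A y))).
  by near=> y; rewrite /invmx (near AU y).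
apply/derivable_mxP => i j; under eq_fun do rewrite mxE.
apply: derivable_mul; last by move/derivable_adj/derivable_mxP: dA.
apply: derivableV; last exact: derivable_det.
by rewrite -unitfE; move/nbhs_singleton: AU; rewrite unitmxE.
Unshelve. all: by end_near. Qed.

End MatrixDerivative.

(** * Linearity in the direction and symmetry of second derivatives for smooth maps *)

Section Smooth.
Context {R : realType} {n : nat}.
Implicit Types (U : set 'rV[R]_n).

Lemma smooth_derivable (V : normedModType R) U (f : 'rV[R]_n -> V) x v :
  smooth_on U f -> U x -> derivable f x v.
Proof. by move=> /(_ 1%N)[_ /(_ v)[+ _]]; exact. Qed.

Lemma smooth_continuous (V : normedModType R) U (f : 'rV[R]_n -> V) x :
  smooth_on U f -> U x -> {for x, continuous f}.
Proof. by move=> /(_ 0%N)[+ _]; exact. Qed.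

Lemma smooth_derive (V : normedModType R) U (f : 'rV[R]_n -> V) v :
  smooth_on U f -> smooth_on U (fun x => 'D_v f x).
Proof. by move=> sf k; have [_ /(_ v)[]] := sf k.+1. Qed.

Lemma continuous_entry (p q : nat) (f : 'rV[R]_n -> 'M[R]_(p, q)) x i j :
  {for x, continuous f} -> {for x, continuous (fun y => f y i j)}.
Proof.
move=> cf; apply: (@continuous_comp _ _ _ f (fun M : 'M[R]_(p, q) => M i j)) => //.
exact: coord_continuous.
Qed.

(** The mean value argument is for scalar functions, so matrix-valued maps are treated entry by
    entry. *)
Lemma smooth_deriveP (p q : nat) U (f : 'rV[R]_n -> 'M[R]_(p, q)) x a u v :
  open U -> smooth_on U f -> U x ->
  'D_(a *: u + v) f x = a *: 'D_u f x + 'D_v f x.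
Proof.
move=> oU sf Ux; apply: derive_val; apply/is_derive_mxP => i j.
have fd y w : U y -> is_derive y w (fun y => f y i j) (('D_w f y) i j).
  by move=> Uy; move: i j; apply/is_derive_mxP; apply: derivableP; exact: smooth_derivable Uy.
rewrite !mxE; apply: (@is_deriveD_dir _ _ _ (fun y => ('D_v f y) i j)).
- by rewrite -[a * _]/(a *: _); apply: is_deriveZdir; exact: fd.
- by near=> y; apply: fd; near: y; exact: open_nbhs_nbhs.
- apply: continuous_entry; exact: smooth_continuous (smooth_derive _ sf) Ux.
Unshelve. all: by end_near. Qed.

Lemma smooth_derive_comm (p q : nat) U (f : 'rV[R]_n -> 'M[R]_(p, q)) x u v :
  open U -> smooth_on U f -> U x ->
  'D_u (fun y => 'D_v f y) x = 'D_v (fun y => 'D_u f y) x.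
Proof.
move=> oU sf Ux; apply/matrixP => i j.
have fd (h : 'rV[R]_n -> 'M[R]_(p, q)) y w : smooth_on U h -> U y ->
    is_derive y w (fun y => h y i j) (('D_w h y) i j).
  by move=> sh Uy; move: i j; apply/is_derive_mxP; apply: derivableP; exact: smooth_derivable Uy.
have UN : \forall y \near x, U y by exact: open_nbhs_nbhs.
apply: (@schwarz _ _ (fun y => f y i j) (fun y => ('D_v f y) i j) (fun y => ('D_u f y) i j)
  (fun y => ('D_u (fun y => 'D_v f y) y) i j) (fun y => ('D_v (fun y => 'D_u f y) y) i j)
  x v u).
- by near=> y; apply: fd => //; near: y.
- by near=> y; apply: fd => //; near: y.
- by near=> y; apply: fd; [exact: smooth_derive|near: y].
- by near=> y; apply: fd; [exact: smooth_derive|near: y].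
- apply: continuous_entry.
  exact: smooth_continuous (smooth_derive _ (smooth_derive _ sf)) Ux.
- apply: continuous_entry.
  exact: smooth_continuous (smooth_derive _ (smooth_derive _ sf)) Ux.
Unshelve. all: by end_near. Qed.

End Smooth.

(** * Symmetries of the Riemann tensor *)

Lemma inner_sharp_linear (R : realType) (n : nat) (M : 'M[R]_n)
    (f : 'rV[R]_n -> R) w :
  M \in unitmx -> (forall a u v, f (a *: u + v) = a * f u + f v) ->
  inner M (sharp M f) w = f w.
Proof.
move=> MU lf; apply/eqP; rewrite -subr_eq0; apply/eqP; move: w.
apply: linear_eq0 => [a u v|i].
  by rewrite innerDr innerZr lf; ring.
by rewrite /inner /sharp mulmxKV // trmx_delta -colE !mxE subrr.
Qed.

Lemma is_derive_inner (R : realType) (n : nat) (V : normedModType R)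
    (A : V -> 'M[R]_n) (c d : V -> 'rV[R]_n) (x v : V) dA dc dd :
  is_derive x v A dA -> is_derive x v c dc -> is_derive x v d dd ->
  is_derive x v (fun y => inner (A y) (c y) (d y))
    (inner dA (c x) (d x) + inner (A x) dc (d x) + inner (A x) (c x) dd).
Proof.
move=> Ad cd dd'; rewrite /inner.
have dT : is_derive x v (fun y => (d y)^T) dd^T.
  apply/is_derive_mxP => i j; rewrite mxE; under eq_fun do rewrite mxE.
  by move/is_derive_mxP: dd'.
have := is_derive_mulmx (is_derive_mulmx cd Ad) dT.
move=> /is_derive_mxP /(_ 0 0); rewrite mulmxDl !mxE.
by congr is_derive; ring.
Qed.

(** Without these, unification of terms containing ['D_v f x] or [christoffel]
    unfolds the limit in their definitions. *)
Ltac derive_generalize :=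
  repeat match goal with
  | |- context [@derive ?K ?V ?W ?f ?x ?v] => generalize (@derive K V W f x v); intro
  end.

Ltac christoffel_generalize :=
  repeat match goal with
  | |- context [christoffel ?g ?x ?u ?v] => generalize (christoffel g x u v); intro
  end.

(** Constant fields commute, so the bracket term is a covariant derivative along the zero field. Its
    vanishing is a hypothesis in order that the formula also serve the warped metric, where it is
    read off the closed form of the Christoffel symbols. *)
Lemma curvature_at_christoffel (R : realType) (n : nat) (g : 'rV[R]_n -> 'M[R]_n)
    (x u v w : 'rV[R]_n) :
  christoffel g x 0 w = 0 ->
  curvature_at g x u v w =
    'D_u (fun y => christoffel g y v w) x + christoffel g x u (christoffel g x v w)
    - ('D_v (fun y => christoffel g y u w) x + christoffel g x v (christoffel g x u w)).
Proof.
move=> G0; rewrite /curvature_at /curvature.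
have covE a b : covD g (cst a) (cst b) = fun y => christoffel g y a b.
  by apply/funext => y; rewrite /covD derive_cst add0r.
have -> : lie_bracket (cst u) (cst v) = cst 0.
  by apply/funext => y; rewrite /lie_bracket !derive_cst subrr.
by rewrite !covE [X in _ - X]G0 subr0.
Qed.

Section Chart.
Context {R : realType} {n : nat} (U : set 'rV[R]_n) (g : 'rV[R]_n -> 'M[R]_n).
Hypotheses (oU : open U) (gS : smooth_on U g).
Hypotheses (gs : forall x, U x -> (g x)^T = g x).
Hypotheses (gu : forall x, U x -> g x \in unitmx).

Lemma nearU x : U x -> \forall y \near x, U y.
Proof. by move=> Ux; exact: open_nbhs_nbhs. Qed.

Lemma is_derive_metric x v : U x -> is_derive x v g ('D_v g x).
Proof. by move=> Ux; apply: derivableP; exact: smooth_derivable Ux. Qed.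

Lemma is_derive_metric2 x u v :
  U x -> is_derive x u (fun y => 'D_v g y) ('D_u (fun y => 'D_v g y) x).
Proof.
by move=> Ux; apply: derivableP; exact: smooth_derivable (smooth_derive _ gS) Ux.
Qed.

Lemma derive_sym (f : 'rV[R]_n -> 'M[R]_n) x w : derivable f x w ->
  (\forall y \near x, (f y)^T = f y) -> ('D_w f x)^T = 'D_w f x.
Proof.
move=> df fs; rewrite derive_mx //; apply/matrixP => i j; rewrite !mxE.
apply: near_eq_derive; near=> y.
by rewrite -[in LHS](near fs y) ?mxE.
Unshelve. all: by end_near. Qed.

Lemma derive_metric_sym x w : U x -> ('D_w g x)^T = 'D_w g x.
Proof.
move=> Ux; apply: derive_sym; first exact: smooth_derivable Ux.
by near=> y; apply: gs; near: y; exact: nearU.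
Unshelve. all: by end_near. Qed.

Lemma derive_metric2_sym x u w : U x ->
  ('D_u (fun y => 'D_w g y) x)^T = 'D_u (fun y => 'D_w g y) x.
Proof.
move=> Ux; apply: derive_sym.
  exact: smooth_derivable (smooth_derive w gS) Ux.
by near=> y; apply: derive_metric_sym; near: y; exact: nearU.
Unshelve. all: by end_near. Qed.

Lemma inner_christoffel x u v w : U x ->
  inner (g x) (christoffel g x u v) w =
  2^-1 * (inner ('D_u g x) v w + inner ('D_v g x) u w - inner ('D_w g x) u v).
Proof.
move=> Ux; rewrite inner_sharp_linear //; first exact: gu.
move=> a y z; rewrite (smooth_deriveP _ _ _ oU gS Ux).
derive_generalize.
by rewrite !innerDr !innerZr inner_mxD inner_mxZ; ring.
Qed.

Lemma christoffel_sym x u v : U x -> christoffel g x u v = christoffel g x v u.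
Proof. by move=> Ux; apply: christoffelC => w; exact: derive_metric_sym. Qed.

Lemma christoffelP x a u v w : U x ->
  christoffel g x u (a *: v + w) = a *: christoffel g x u v + christoffel g x u w.
Proof.
move=> Ux; apply: (inner_inj (gu Ux)) => z.
rewrite innerDl innerZl !inner_christoffel // (smooth_deriveP _ _ _ oU gS Ux).
derive_generalize.
by rewrite !innerDl !innerDr !innerZl !innerZr inner_mxD inner_mxZ; ring.
Qed.

Lemma christoffelZr x a u v : U x ->
  christoffel g x u (a *: v) = a *: christoffel g x u v.
Proof.
move=> Ux; apply: (inner_inj (gu Ux)) => z.
have DZ : 'D_(a *: v) g x = a *: 'D_v g x.
  by rewrite -[a *: v]addr0 (smooth_deriveP _ _ _ oU gS Ux) derive0 addr0.
rewrite innerZl !inner_christoffel //; move: DZ; derive_generalize => ->.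
by rewrite !innerZl !innerZr inner_mxZ; ring.
Qed.

Lemma christoffel0l x v : U x -> christoffel g x 0 v = 0.
Proof.
move=> Ux; rewrite christoffel_sym //.
by have := christoffelZr 0 v 0 Ux; rewrite !scale0r.
Qed.

Lemma metric_compat x u v w : U x ->
  inner ('D_u g x) v w =
  inner (g x) (christoffel g x u v) w + inner (g x) v (christoffel g x u w).
Proof.
move=> Ux; rewrite (innerC v _ (gs Ux)) !inner_christoffel //.
move: (innerC w v (derive_metric_sym u Ux)); derive_generalize => ->.
by inner_generalize; field.
Qed.

Lemma derivable_christoffel x u v w :
  U x -> derivable (fun y => christoffel g y v w) x u.
Proof.
move=> Ux; rewrite /christoffel /sharp; apply: ex_derive.
apply: is_derive_mulmx; last first.
  apply: derivableP; apply: derivable_invmx; last exact: smooth_derivable Ux.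
  by near=> y; apply: gu; near: y; exact: nearU.
apply: derivableP; apply/derivable_mxP => i k; under eq_fun do rewrite mxE.
apply: derivable_mul; first exact: derivable_cst.
have dI a b c : derivable (fun y => inner ('D_a g y) b c) x u.
  apply: ex_derive; apply: is_derive_inner.
  exact: is_derive_metric2.
apply: derivableB; last exact: dI.
by apply: derivableD; exact: dI.
Unshelve. all: by end_near. Qed.

Lemma curvature_atE x u v w : U x ->
  curvature_at g x u v w =
    'D_u (fun y => christoffel g y v w) x + christoffel g x u (christoffel g x v w)
    - ('D_v (fun y => christoffel g y u w) x + christoffel g x v (christoffel g x u w)).
Proof.
move=> Ux; apply: curvature_at_christoffel; exact: christoffel0l.
Qed.

(** The Koszul formula for the pairing is differentiated by the product rule, and [metric_compat]
    rewrites the term in which the metric is differentiated. This yields a lowered formula free of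
    derivatives of the inverse matrix. *)
Lemma inner_derive_christoffel x u v w z : U x ->
  inner (g x) ('D_u (fun y => christoffel g y v w) x) z =
  2^-1 * (inner ('D_u (fun y => 'D_v g y) x) w z
          + inner ('D_u (fun y => 'D_w g y) x) v z
          - inner ('D_u (fun y => 'D_z g y) x) v w)
  - inner (g x) (christoffel g x u (christoffel g x v w)) z
  - inner (g x) (christoffel g x v w) (christoffel g x u z).
Proof.
move=> Ux.
have dG : is_derive x u (fun y => christoffel g y v w)
    ('D_u (fun y => christoffel g y v w) x).
  by apply: derivableP; exact: derivable_christoffel.
have lhs := is_derive_inner (is_derive_metric u Ux) dG (is_derive_cst z x u).
rewrite inner0r addr0 in lhs.
have rhs : is_derive x u (fun y => inner (g y) (christoffel g y v w) z)
   (2^-1 * (inner ('D_u (fun y => 'D_v g y) x) w z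
          + inner ('D_u (fun y => 'D_w g y) x) v z
          - inner ('D_u (fun y => 'D_z g y) x) v w)).
  apply: (@near_eq_is_derive _ _ _ (fun y => 2^-1 * (inner ('D_v g y) w z
     + inner ('D_w g y) v z - inner ('D_z g y) v w))).
    near=> y; rewrite inner_christoffel //; near: y; exact: nearU.
  have dI a b c : is_derive x u (fun y => inner ('D_a g y) b c)
      (inner ('D_u (fun y => 'D_a g y) x) b c).
    have := is_derive_inner (is_derive_metric2 u a Ux) (is_derive_cst b x u) (is_derive_cst c x u).
    by rewrite (inner0l ('D_a g x)) (inner0r ('D_a g x)) !addr0.
  exact: (is_deriveZ 2^-1 (is_deriveB (is_deriveD (dI v w z) (dI w v z)) (dI z v w))).
have [_ E1] := lhs; have [_ E2] := rhs.
have C := metric_compat u (christoffel g x v w) z Ux.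
by move: E1 C; rewrite E2 /cst; inner_generalize => -> ->; ring.
Unshelve. all: by end_near. Qed.

Lemma curvature_like_curvature_at x : U x ->
  curvature_like (fun X Y Z W => inner (g x) (curvature_at g x X Y Z) W).
Proof.
move=> Ux; split=> [X Y Z W|X Y Z W|X Y Z W|X Y Z a V W].
- by rewrite !curvature_atE // -innerNl opprB.
- have E a b c d : inner (g x) (curvature_at g x a b c) d =
      2^-1 * (inner ('D_a (fun y => 'D_b g y) x) c d
          + inner ('D_a (fun y => 'D_c g y) x) b d
          - inner ('D_a (fun y => 'D_d g y) x) b c)
      - inner (g x) (christoffel g x b c) (christoffel g x a d)
      - (2^-1 * (inner ('D_b (fun y => 'D_a g y) x) c d
          + inner ('D_b (fun y => 'D_c g y) x) a d
          - inner ('D_b (fun y => 'D_d g y) x) a c)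
      - inner (g x) (christoffel g x a c) (christoffel g x b d)).
    have := inner_derive_christoffel a b c d Ux.
    have := inner_derive_christoffel b a c d Ux.
    rewrite curvature_atE //.
    generalize ('D_a (fun y => christoffel g y b c) x) => d1.
    generalize ('D_b (fun y => christoffel g y a c) x) => d2.
    rewrite innerBl !innerDl => -> ->.
    by inner_generalize; ring.
  (* Under antisymmetrisation in the last pair all second derivatives cancel by themselves except
     the mixed ones along [X] and [Y], evaluated on [Z] and [W]. *)
  have comm : 'D_Y (fun y => 'D_X g y) x = 'D_X (fun y => 'D_Y g y) x.
    exact: smooth_derive_comm oU gS Ux.
  move: comm (innerC W Z (derive_metric2_sym X Y Ux)).
  move: (innerC (christoffel g x Y W) (christoffel g x X Z) (gs Ux)).
  move: (innerC (christoffel g x X W) (christoffel g x Y Z) (gs Ux)).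
  rewrite !E {E}; derive_generalize; christoffel_generalize.
  move=> + + ->; inner_generalize => -> -> ->.
  by field.
(* The Bianchi identity reflects the vanishing torsion: the Christoffel symbols are symmetric near
   [x], hence so are their derivatives, and the terms cancel in pairs. *)
- have dsym a b c : 'D_a (fun y => christoffel g y b c) x =
      'D_a (fun y => christoffel g y c b) x.
    apply: near_eq_derive; near=> y; apply: christoffel_sym; near: y; exact: nearU.
  rewrite !curvature_atE // (dsym X Z Y) (dsym Y Z X) (dsym Z Y X).
  rewrite (christoffel_sym Z Y Ux) (christoffel_sym Z X Ux) (christoffel_sym Y X Ux).
  derive_generalize; christoffel_generalize.
  by rewrite !innerBl !innerDl; ring.
- by rewrite innerDr innerZr.
Unshelve. all: by end_near. Qed.

End Chart.

(** * Curvature of a warped metric *)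

Lemma is_derive_linear_comp (R : realType) (V V' W : normedModType R)
    (L : {linear V -> V'}) (f : V' -> W) (x v : V) d :
  is_derive (L x) (L v) f d -> is_derive x v (fun y => f (L y)) d.
Proof.
move=> [df <-].
have E : (fun h : R => h^-1 *: (((fun y => f (L y)) \o shift x) (h *: v) - f (L x)))
    = (fun h => h^-1 *: ((f \o shift (L x)) (h *: L v) - f (L x))).
  by apply/funext => h /=; rewrite linearP.
by split; [rewrite /derivable E|rewrite /derive E].
Qed.

Lemma is_derive_row_mx (R : realType) (V : normedModType R) (m n : nat)
    (A : V -> 'rV[R]_m) (B : V -> 'rV[R]_n) (x v : V) dA dB :
  is_derive x v A dA -> is_derive x v B dB ->
  is_derive x v (fun y => row_mx (A y) (B y)) (row_mx dA dB).
Proof.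
move=> /is_derive_mxP Ad /is_derive_mxP Bd; apply/is_derive_mxP => i j.
case: (split_ordP j) => k ->.
  by rewrite row_mxEl; under eq_fun do rewrite row_mxEl; exact: Ad.
by rewrite row_mxEr; under eq_fun do rewrite row_mxEr; exact: Bd.
Qed.

Lemma is_derive_block_diag (R : realType) (V : normedModType R) (m n : nat)
    (A : V -> 'M[R]_m) (D : V -> 'M[R]_n) (x v : V) dA dD :
  is_derive x v A dA -> is_derive x v D dD ->
  is_derive x v (fun y => block_mx (A y) 0 0 (D y)) (block_mx dA 0 0 dD).
Proof.
move=> /is_derive_mxP Ad /is_derive_mxP Dd; apply/is_derive_mxP => i j.
case: (split_ordP i) => k ->; case: (split_ordP j) => l ->.
- by rewrite block_mxEul; under eq_fun do rewrite block_mxEul; exact: Ad.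
- by rewrite block_mxEur mxE; under eq_fun do rewrite block_mxEur mxE; exact: is_derive_cst.
- by rewrite block_mxEdl mxE; under eq_fun do rewrite block_mxEdl mxE; exact: is_derive_cst.
- by rewrite block_mxEdr; under eq_fun do rewrite block_mxEdr; exact: Dd.
Qed.

Lemma is_derive_scale (R : realType) (V : normedModType R) (m n : nat)
    (k : V -> R) (A : V -> 'M[R]_(m, n)) (x v : V) dk dA :
  is_derive x v k dk -> is_derive x v A dA ->
  is_derive x v (fun y => k y *: A y) (dk *: A x + k x *: dA).
Proof.
move=> kd /is_derive_mxP Ad; apply/is_derive_mxP => i j.
rewrite !mxE; under eq_fun do rewrite mxE.
exact: is_derive_mul.
Qed.

Lemma inner_block_diag (R : realType) (m n : nat) (A : 'M[R]_m) (D : 'M[R]_n)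
    (u w : 'rV[R]_(m + n)) :
  inner (block_mx A 0 0 D) u w =
    inner A (lsubmx u) (lsubmx w) + inner D (rsubmx u) (rsubmx w).
Proof.
rewrite /inner -[in LHS](hsubmxK u) -[in LHS](hsubmxK w) mul_row_block tr_row_mx.
by rewrite !mulmx0 addr0 add0r mul_row_col mxE.
Qed.

Lemma inner11 (R : realType) (A : 'M[R]_1) (u w : 'rV[R]_1) :
  inner A u w = A 0 0 * u 0 0 * w 0 0.
Proof. by rewrite inner_sum !big_ord1 mulrA. Qed.

Lemma invmx_unique (R : realType) (n : nat) (A A' : 'M[R]_n) :
  A *m A' = 1%:M -> A \in unitmx /\ invmx A = A'.
Proof.
move=> AA'; have [AU _] := mulmx1_unit AA'; split=> //.
by rewrite -[RHS](mulKmx AU) AA' mulmx1.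
Qed.

Lemma block_diag_inv (R : realType) (m n : nat) (A : 'M[R]_m) (D : 'M[R]_n) :
  A \in unitmx -> D \in unitmx ->
  block_mx A 0 0 D \in unitmx /\
  invmx (block_mx A 0 0 D) = block_mx (invmx A) 0 0 (invmx D).
Proof.
move=> AU DU; apply: invmx_unique.
rewrite mulmx_block !mulmx0 !mul0mx !addr0 !add0r !mulmxV //.
by rewrite scalar_mx_block.
Qed.

Section Warped.
Context {R : realType} {n : nat} (U1 : set 'rV[R]_1) (U2 : set 'rV[R]_n).
Context (beta : 'rV[R]_1 -> 'M[R]_1) (phi : 'rV[R]_1 -> R) (g : 'rV[R]_n -> 'M[R]_n).
Hypotheses (oU1 : open U1) (oU2 : open U2).
Hypotheses (betaS : smooth_on U1 beta) (phiS : smooth_on U1 phi) (gS : smooth_on U2 g).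
Hypotheses (betau : forall t, U1 t -> beta t \in unitmx).
Hypotheses (phi0 : forall t, U1 t -> phi t != 0).
Hypotheses (gs : forall x, U2 x -> (g x)^T = g x).
Hypotheses (gu : forall x, U2 x -> g x \in unitmx).

Let G (x : 'rV[R]_(1 + n)) : 'M[R]_(1 + n) :=
  block_mx (beta (lsubmx x)) 0 0 (phi (lsubmx x) *: g (rsubmx x)).
Let e : 'rV[R]_1 := const_mx 1.
Let b (t : 'rV[R]_1) : R := beta t 0 0.
Let b1 (t : 'rV[R]_1) : R := 'D_e beta t 0 0.
Let f1 (t : 'rV[R]_1) : R := 'D_e phi t.
(** With 0 the base index, these are the nonzero Christoffel symbols beyond those of the fibre: [p]
    is Gamma^0_00, [- q] times [g_ij] is Gamma^0_ij, and [r] is the coefficient of the identity in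
    Gamma^i_0j. *)
Let p (t : 'rV[R]_1) : R := b1 t / (2 * b t).
Let q (t : 'rV[R]_1) : R := f1 t / (2 * b t).
Let r (t : 'rV[R]_1) : R := f1 t / (2 * phi t).

Let b0 t : U1 t -> b t != 0.
Proof. by move=> /betau; rewrite unitmxE det_mx11 unitfE. Qed.

Let rV1E (s : 'rV[R]_1) : s = s 0 0 *: e.
Proof. by apply/rowP => i; rewrite ord1 !mxE mulr1. Qed.

Let is_derive_base (W : normedModType R) (k : 'rV[R]_1 -> W) (x u : 'rV[R]_(1 + n)) d :
  is_derive (lsubmx x) e k d ->
  is_derive x u (fun y => k (lsubmx y)) (lsubmx u 0 0 *: d).
Proof.
move=> kd; apply: (@is_derive_linear_comp _ _ _ _ (@lsubmx R 1 1 n)).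
by rewrite [X in is_derive _ X](rV1E (lsubmx u)); exact: is_deriveZdir.
Qed.

Let GU x : U1 (lsubmx x) -> U2 (rsubmx x) -> G x \in unitmx.
Proof.
move=> x1 x2; have [//||//] := @block_diag_inv _ _ _ (beta (lsubmx x))
  (phi (lsubmx x) *: g (rsubmx x)).
  exact: betau.
by rewrite unitmxZ ?gu // unitfE phi0.
Qed.

Let is_derive_G x u : U1 (lsubmx x) -> U2 (rsubmx x) ->
  is_derive x u G (block_mx (lsubmx u 0 0 *: 'D_e beta (lsubmx x)) 0 0
    ((lsubmx u 0 0 * f1 (lsubmx x)) *: g (rsubmx x)
     + phi (lsubmx x) *: 'D_(rsubmx u) g (rsubmx x))).
Proof.
move=> x1 x2; apply: is_derive_block_diag.
  apply: is_derive_base; apply: derivableP; exact: smooth_derivable x1.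
apply: is_derive_scale.
  apply: (is_derive_base (k := phi)); apply: derivableP; exact: smooth_derivable x1.
apply: (@is_derive_linear_comp _ _ _ _ (@rsubmx R 1 1 n)).
apply: derivableP; exact: smooth_derivable x2.
Qed.

Let christoffel_warped x u v : U1 (lsubmx x) -> U2 (rsubmx x) ->
  christoffel G x u v =
    row_mx ((p (lsubmx x) * (lsubmx u 0 0 * lsubmx v 0 0)
             - q (lsubmx x) * inner (g (rsubmx x)) (rsubmx u) (rsubmx v)) *: e)
      (r (lsubmx x) *: (lsubmx u 0 0 *: rsubmx v + lsubmx v 0 0 *: rsubmx u)
       + christoffel g (rsubmx x) (rsubmx u) (rsubmx v)).
Proof.
move=> x1 x2; apply: sharp_unique; first exact: GU.
move=> w; rewrite inner_block_diag row_mxKl row_mxKr inner_mxZ !inner11.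
pose dg (z : 'rV[R]_(1 + n)) : 'M[R]_n := 'D_(rsubmx z) g (rsubmx x).
have C : inner (g (rsubmx x)) (christoffel g (rsubmx x) (rsubmx u) (rsubmx v)) (rsubmx w) =
    2^-1 * (inner (dg u) (rsubmx v) (rsubmx w) + inner (dg v) (rsubmx u) (rsubmx w)
            - inner (dg w) (rsubmx u) (rsubmx v)).
  exact: (inner_christoffel oU2 gS gu).
rewrite !innerDl !innerZl innerDl !innerZl C.
have DG z : 'D_z G x = block_mx (lsubmx z 0 0 *: 'D_e beta (lsubmx x)) 0 0
    ((lsubmx z 0 0 * f1 (lsubmx x)) *: g (rsubmx x) + phi (lsubmx x) *: dg z).
  exact: (@derive_val _ _ _ _ _ _ _ (is_derive_G z x1 x2)).
move: (DG u) (DG v) (DG w) (b0 x1) (phi0 x1); rewrite /p /q /r /b /b1.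
generalize ('D_u G x) ('D_v G x) ('D_w G x) (f1 (lsubmx x)) (dg u) (dg v) (dg w).
move=> Gu Gv Gw f1x dgu dgv dgw {C DG dg}.
derive_generalize => -> -> ->.
rewrite !inner_block_diag ?inner_mxD ?inner_mxZ !inner11 !mxE.
move: (beta (lsubmx x) 0 0) (phi (lsubmx x)) => b' f'.
inner_generalize => b'0 f'0.
rewrite mulr1; field.
by rewrite f'0.
Qed.

Let is_derive_christoffel_warped x u v w p1 q1 r1 dg dG :
  U1 (lsubmx x) -> U2 (rsubmx x) ->
  is_derive (lsubmx x) e p p1 -> is_derive (lsubmx x) e q q1 ->
  is_derive (lsubmx x) e r r1 -> is_derive (rsubmx x) (rsubmx u) g dg ->
  is_derive (rsubmx x) (rsubmx u)
    (fun y => christoffel g y (rsubmx v) (rsubmx w)) dG ->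
  is_derive x u (fun z => christoffel G z v w)
    (row_mx ((lsubmx u 0 0 * p1 * (lsubmx v 0 0 * lsubmx w 0 0)
              - (lsubmx u 0 0 * q1 * inner (g (rsubmx x)) (rsubmx v) (rsubmx w)
                 + q (lsubmx x) * inner dg (rsubmx v) (rsubmx w))) *: e)
       ((lsubmx u 0 0 * r1) *: (lsubmx v 0 0 *: rsubmx w + lsubmx w 0 0 *: rsubmx v)
       + dG)).
Proof.
move=> x1 x2 pd qd rd gd Gd.
have lc : continuous (@lsubmx R 1 1 n).
  by move=> z; apply: differentiable_continuous; exact: differentiable_lsubmx.
have rc : continuous (@rsubmx R 1 1 n).
  by move=> z; apply: differentiable_continuous; exact: differentiable_rsubmx.
apply: near_eq_is_derive.
  near=> z; apply/esym; apply: christoffel_warped; near: z.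
    by apply: lc; exact: open_nbhs_nbhs.
  by apply: rc; exact: open_nbhs_nbhs.
apply: is_derive_row_mx.
  have := is_derive_scale _ (is_derive_cst e x u).
  rewrite /cst => H; rewrite -[X in is_derive _ _ _ X]addr0 -[X in _ + X](scaler0 _
    (p (lsubmx x) * (lsubmx v 0 0 * lsubmx w 0 0)
      - q (lsubmx x) * inner (g (rsubmx x)) (rsubmx v) (rsubmx w))).
  apply: H; apply: is_deriveB.
    have := is_derive_mul (is_derive_base u pd) (is_derive_cst (lsubmx v 0 0 * lsubmx w 0 0) x u).
    by rewrite mulr0 addr0.
  apply: (is_derive_mul (is_derive_base u qd)).
  have := is_derive_inner gd (is_derive_cst (rsubmx v) (rsubmx x) (rsubmx u))
    (is_derive_cst (rsubmx w) _ _).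
  rewrite inner0l inner0r !addr0.
  exact: (@is_derive_linear_comp _ _ _ _ (@rsubmx R 1 1 n)).
apply: is_derive_add.
  have := is_derive_scale (is_derive_base u rd)
    (is_derive_cst (lsubmx v 0 0 *: rsubmx w + lsubmx w 0 0 *: rsubmx v) x u).
  by rewrite scaler0 addr0.
exact: (@is_derive_linear_comp _ _ _ _ (@rsubmx R 1 1 n)
  (fun y => christoffel g y (rsubmx v) (rsubmx w))).
Unshelve. all: by end_near. Qed.

Lemma curvature_warped x : U1 (lsubmx x) -> U2 (rsubmx x) ->
  exists m l : R, forall u v w z,
    inner (G x) (curvature_at G x u v w) z =
      phi (lsubmx x) * inner (g (rsubmx x))
         (curvature_at g (rsubmx x) (rsubmx u) (rsubmx v) (rsubmx w)) (rsubmx z)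
      + m * kn (inner (g (rsubmx x))) (inner (g (rsubmx x)))
          (rsubmx u) (rsubmx v) (rsubmx w) (rsubmx z)
      + l * kn (fun u v => lsubmx u 0 0 * lsubmx v 0 0)
          (fun u v => inner (g (rsubmx x)) (rsubmx u) (rsubmx v)) u v w z.
Proof.
move=> x1 x2; set t := lsubmx x; set y := rsubmx x.
have bd s : U1 s -> is_derive s e b (b1 s).
  move=> s1; have := derivableP (smooth_derivable (v := e) betaS s1).
  by move/is_derive_mxP => /(_ 0 0).
have b1d : derivable b1 t e.
  have := smooth_derivable (v := e) (smooth_derive e betaS) x1.
  by move/derivable_mxP => /(_ 0 0).
have fd s : U1 s -> is_derive s e phi (f1 s).
  by move=> s1; apply: derivableP; exact: smooth_derivable s1.
have f1d : derivable f1 t e by exact: smooth_derivable (smooth_derive e phiS) x1.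
have twod (k : 'rV[R]_1 -> R) : k t != 0 -> derivable k t e ->
    derivable (fun s => (2 * k s)^-1) t e.
  move=> k0 kd; apply: derivableV; first by rewrite mulf_neq0 // pnatr_eq0.
  by apply: derivable_mul; first exact: derivable_cst.
have bdt : derivable b t e by have [] := bd t x1.
have fdt : derivable phi t e by have [] := fd t x1.
have pd : is_derive t e p ('D_e p t).
  apply: derivableP; apply: derivable_mul; first exact: b1d.
  by apply: twod; [exact: b0|exact: bdt].
have qd : is_derive t e q ('D_e q t).
  apply: derivableP; apply: derivable_mul; first exact: f1d.
  by apply: twod; [exact: b0|exact: bdt].
have rd : is_derive t e r ('D_e r t).
  apply: derivableP; apply: derivable_mul; first exact: f1d.
  by apply: twod; [exact: phi0|exact: fdt].
move: ('D_e p t) ('D_e q t) ('D_e r t) pd qd rd => p1 q1 r1 pd qd rd.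
(* Both sides are half the derivative of [phi]. Differentiating this relation expresses [q1] through
   [r1], so that second derivatives of [phi] enter the final identity through one variable only. *)
have bq s : U1 s -> b s * q s = phi s * r s.
  by move=> s1; rewrite /q /r; field; rewrite b0 // phi0.
have rel : b1 t * q t + b t * q1 = f1 t * r t + phi t * r1.
  have [_ <-] := is_derive_mul (bd t x1) qd; have [_ <-] := is_derive_mul (fd t x1) rd.
  by apply: near_eq_derive; near=> s; apply: bq; near: s; exact: nearU.
have qE : q t = phi t * r t / b t by rewrite -bq // mulrAC divff ?b0 // mul1r.
have q1E : q1 = (2 * phi t * r t ^+ 2 + phi t * r1 - 2 * b t * p t * q t) / b t.
  have b1E : b1 t = 2 * b t * p t by rewrite /p; field; exact: b0.
  have f1E : f1 t = 2 * phi t * r t by rewrite /r; field; exact: phi0.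
  have -> : phi t * r1 = b1 t * q t + b t * q1 - f1 t * r t by rewrite rel; ring.
  by rewrite b1E f1E; field; exact: b0.
(* For [phi = h ^+ 2] these are the classical coefficients: minus half of [phi] times the squared
   length of [dh], and [- h] times the Hessian of [h] on the coordinate vector of the base. *)
exists (- (phi t * r t * q t / 2)), (- (phi t * (r1 + r t ^+ 2 - r t * p t))).
move=> u v w z.
pose dg k : 'M[R]_n := 'D_k g y.
pose dG k c d : 'rV[R]_n := 'D_k (fun s => christoffel g s c d) y.
have gd k : is_derive y k g (dg k) by exact: is_derive_metric.
have Gd k c d : is_derive y k (fun s => christoffel g s c d) (dG k c d).
  by apply: derivableP; exact: derivable_christoffel x2.
have DG (a c d : 'rV[R]_(1 + n)) := @derive_val _ _ _ _ _ _ _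
  (is_derive_christoffel_warped x1 x2 pd qd rd (gd (rsubmx a))
     (Gd (rsubmx a) (rsubmx c) (rsubmx d))).
rewrite curvature_at_christoffel; last first.
  have L0 : lsubmx (0 : 'rV[R]_(1 + n)) 0 0 = 0 by rewrite !mxE.
  have R0 : rsubmx (0 : 'rV[R]_(1 + n)) = 0 by rewrite linear0.
  rewrite christoffel_warped // L0 R0 (christoffel0l oU2 gS gs gu) //.
  by rewrite inner0l mul0r !mulr0 subrr !scale0r !scaler0 !addr0 scaler0 row_mx0.
move: (DG u v w) (DG v u w).
generalize ('D_u (fun y => christoffel G y v w) x) ('D_v (fun y => christoffel G y u w) x).
move=> d1 d2 -> -> {DG}.
rewrite !christoffel_warped // !row_mxKl !row_mxKr -/t -/y.
(* The base component of the differentiated symbols contains derivatives of [g]; metric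
   compatibility turns them into Christoffel terms, which cancel against the quadratic part of the
   curvature. *)
have Mu a c d : inner (dg a) c d =
    inner (g y) (christoffel g y a c) d + inner (g y) c (christoffel g y a d).
  exact: (metric_compat oU2 gS gs gu a c d x2).
have CE : curvature_at g y (rsubmx u) (rsubmx v) (rsubmx w) =
    dG (rsubmx u) (rsubmx v) (rsubmx w) +
      christoffel g y (rsubmx u) (christoffel g y (rsubmx v) (rsubmx w))
    - (dG (rsubmx v) (rsubmx u) (rsubmx w)
       + christoffel g y (rsubmx v) (christoffel g y (rsubmx u) (rsubmx w))).
  exact: (curvature_atE oU2 gS gs gu (rsubmx u) (rsubmx v) (rsubmx w) x2).
have CP a1 a2 k c d m : christoffel g y k (r t *: (a1 *: c + a2 *: d) + m) =
    r t *: (a1 *: christoffel g y k c + a2 *: christoffel g y k d) + christoffel g y k m.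
  rewrite (christoffelP oU2 gS gu) // (christoffelP oU2 gS gu) //.
  by rewrite (christoffelZr oU2 gS gu).
have vu := innerC (rsubmx v) (rsubmx u) (gs x2).
rewrite CE (CP _ _ (rsubmx u) (rsubmx w) (rsubmx v)) (CP _ _ (rsubmx v) (rsubmx w) (rsubmx u)).
rewrite (christoffel_sym oU2 gS gs (rsubmx v) (rsubmx u)) //.
move: (b0 x1) (phi0 x1) vu.
move: q1E qE (Mu (rsubmx u) (rsubmx v) (rsubmx w)) (Mu (rsubmx v) (rsubmx u) (rsubmx w)).
rewrite -/t -/y.
move: (gs x2) (christoffel_sym oU2 gS gs (rsubmx v) (rsubmx u) x2); rewrite -/y => gsy.
rewrite /kn /G /b -/t -/y.
move: (beta t) (g y) (phi t) (p t) (q t) (r t) => BB gg f pp qq rr.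
generalize (dg (rsubmx u)) (dg (rsubmx v)) (dG (rsubmx u) (rsubmx v) (rsubmx w))
  (dG (rsubmx v) (rsubmx u) (rsubmx w)) => dgu dgv dGu dGv.
christoffel_generalize => -> q1E qE -> -> b0' f0' vu.
have IG (X : R) Y : inner (block_mx BB 0 0 (f *: gg)) (row_mx (X *: e) Y) z =
    BB 0 0 * X * lsubmx z 0 0 + f * inner gg Y (rsubmx z).
  by rewrite inner_block_diag row_mxKl row_mxKr inner_mxZ inner11 !mxE mulr1.
have eE (X : R) : (X *: e) 0 0 = X by rewrite !mxE mulr1.
rewrite !eE !innerBl !innerDl !IG {IG eE}.
rewrite !(innerDl, innerZl) !(innerDr, innerZr).
rewrite vu q1E qE.
move: (lsubmx u 0 0) (lsubmx v 0 0) (lsubmx w 0 0) (lsubmx z 0 0) => a c d h.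
move: (BB 0 0) b0' => bb b0'.
inner_generalize.
by field; rewrite b0'.
Unshelve. all: by end_near. Qed.

End Warped.

(** * The identities at a point *)

Section TensorAction.
Context {R : realType} {n : nat}.
Implicit Types (T U B : tensor4 R n).

(** Additivity in the acting tensor needs additivity of [T] in every slot, obtained from the last
    one by the symmetries. *)
Lemma dotDl (g : 'M[R]_n) B B' T : curvature_like T ->
  dot g (B + B') T = dot g B T + dot g B' T.
Proof.
move=> cT.
have D4 X1 X2 X3 (U V : 'rV[R]_n) : T X1 X2 X3 (U + V) = T X1 X2 X3 U + T X1 X2 X3 V.
  by rewrite -[U]scale1r (curv_linear cT) mul1r scale1r.
have D3 X1 X2 (U V : 'rV[R]_n) X4 : T X1 X2 (U + V) X4 = T X1 X2 U X4 + T X1 X2 V X4.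
  by rewrite !(curv34 cT _ _ _ X4) D4 opprD.
have D2 X1 (U V : 'rV[R]_n) X3 X4 : T X1 (U + V) X3 X4 = T X1 U X3 X4 + T X1 V X3 X4.
  by rewrite !(curv_pair X1 _ _ _ cT) D4.
have D1 (U V : 'rV[R]_n) X2 X3 X4 : T (U + V) X2 X3 X4 = T U X2 X3 X4 + T V X2 X3 X4.
  by rewrite !(curv12 cT _ X2) D2 opprD.
apply/funext => X1; apply/funext => X2; apply/funext => X3; apply/funext => X4.
apply/funext => X; apply/funext => Y; rewrite tensor6D /dot /der_act.
have sD Z : sharp g ((B + B') X Y Z) = sharp g (B X Y Z) + sharp g (B' X Y Z).
  exact: sharpD.
rewrite !sD D1 D2 D3 D4.
by ring.
Qed.

Lemma der_actD (D : 'rV[R]_n -> 'rV[R]_n -> 'rV[R]_n -> 'rV[R]_n) T U :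
  der_act D (T + U) = der_act D T + der_act D U.
Proof.
apply/funext => X1; apply/funext => X2; apply/funext => X3; apply/funext => X4.
apply/funext => X; apply/funext => Y; rewrite tensor6D /der_act !tensor4D.
by ring.
Qed.

Lemma dotDr (g : 'M[R]_n) B T U : dot g B (T + U) = dot g B T + dot g B U.
Proof. exact: der_actD. Qed.

Lemma QD (A : tensor2 R n) T U : Q A (T + U) = Q A T + Q A U.
Proof. exact: der_actD. Qed.

(** Expanding the action of [C + W] on itself isolates the mixed terms; [Q A W] occurs once from [W]
    acting on itself and once inside [Q A (C + W)], and drops out. *)
Lemma dot_add_mixed (g : 'M[R]_n) (A : tensor2 R n) (C W : tensor4 R n)
    (K L : tensor6 R n) :
  curvature_like C -> curvature_like W -> dot g W W = Q A W + K ->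
  dot g (C + W) (C + W) - Q A (C + W) = L ->
  dot g C (C + W) + dot g (C + W) C = Q A C + L + dot g C C - K.
Proof.
move=> cC cW; rewrite !dotDr !dotDl // QD.
move: (Q A C) (Q A W) (dot g C C) (dot g C W) (dot g W C) (dot g W W).
move=> QAC QAW CC CW WC WW E1 E2.
apply/funext => X1; apply/funext => X2; apply/funext => X3; apply/funext => X4.
apply/funext => X; apply/funext => Y.
have {}E1 := congr1 (fun f : tensor6 R n => f X1 X2 X3 X4 X Y) E1.
have {}E2 := congr1 (fun f : tensor6 R n => f X1 X2 X3 X4 X Y) E2.
move: E1 E2; rewrite /= !(tensor6D, tensor6N, tensor6Z).
lra.
Qed.

End TensorAction.

Section Point.
Context {R : realType} {n : nat} (M : semiriem R n) (p : M).
Hypothesis gU : gram p \in unitmx.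

Lemma ST_ricci : ST p = ricci (gram p) (RT p).
Proof.
apply/funext => X; apply/funext => Y; congr op_trace; apply/funext => Z.
by apply/esym/sharp_unique.
Qed.

Lemma Sop_mx (S : 'M[R]_n) X : ST p = inner S -> Sop p X = X *m (S *m invmx (gram p)).
Proof.
move=> SE; apply: sharp_unique => // w.
by rewrite SE inner_mulmxl mulmxKV.
Qed.

Lemma S2T_mx (S : 'M[R]_n) :
  ST p = inner S -> S2T p = inner (S *m invmx (gram p) *m S).
Proof.
move=> SE; apply/funext => X; apply/funext => Y.
by rewrite /S2T (Sop_mx _ SE) SE inner_mulmxl.
Qed.

Lemma kappa_mx (S : 'M[R]_n) : ST p = inner S -> kappa p = \tr (S *m invmx (gram p)).
Proof.
move=> SE; rewrite /kappa -op_trace_mulmx; congr op_trace.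
by apply/funext => X; exact: Sop_mx.
Qed.

End Point.

(** A rank factorisation gives a column times a row; symmetry, read at a nonzero entry of the row,
    makes the two proportional. The factor [c] keeps the sign, so no square root is taken. *)
Lemma symmetric_rank1 (R : realType) (n : nat) (E : 'M[R]_n) :
  E^T = E -> \rank E = 1%N -> exists (c : R) (v : 'rV[R]_n), E = c *: (v^T *m v).
Proof.
move=> sE rkE; have := mulmx_base E.
move: (col_base E) (row_base E); rewrite rkE => c v cv.
have [j vj] : exists j, v 0 j != 0.
  apply/existsP; apply: contra_eqT rkE; rewrite negb_exists => /forallP v0.
  have -> : E = 0; last by rewrite mxrank0.
  rewrite -cv; suff -> : v = 0 by rewrite mulmx0.
  by apply/rowP => k; rewrite mxE; apply/eqP; rewrite -[_ == _]negbK; exact: v0.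
exists (c j 0 / v 0 j), v; apply/matrixP => i k.
have cvE a d : E a d = c a 0 * v 0 d by rewrite -cv mxE big_ord1.
have : E i j = E j i by rewrite -[in LHS]sE mxE.
rewrite !cvE !mxE big_ord1 mxE => cij.
have -> : c i 0 = c j 0 * v 0 i / v 0 j by rewrite -cij mulfK.
by field.
Qed.

(** * The curvature of the warped product in the frame at a point *)

Section WarpedPoint.
Context {R : realType} (B : semiriem R 1) (N : semiriem R 3) (F : B -> R).
Hypotheses (hB : semiriemannian B) (hN : semiriemannian N).
Hypotheses (hF : smooth_fun B F) (hF0 : forall t : B, 0 < F t).
Let M := warped B N F.
Context (p : M).

Let beta : 'M[R]_1 := gram p.1.
Let g : 'M[R]_3 := gram p.2.
(* This is F p.1, in the form to which [metric (warped B N F)] computes. *)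
Let f : R := F (Defs.cpoint (chart_of (index_at p.1)) (coord_at p.1)).
Let b := beta 0 0.
Let H : 'M[R]_(1 + 3) := block_mx 0 0 0 (f *: g).
Let T : 'M[R]_(1 + 3) := block_mx 1%:M 0 0 0.
Let gi := invmx (gram p).

Lemma cimage_coord_at (m : nat) (K : semiriem R m) (q : K) : semiriemannian K ->
  cimage (chart_of (index_at q)) (coord_at q).
Proof. by move=> hK; exists q => //; exact: sr_index_at. Qed.

Let i1 := cimage_coord_at p.1 hB.
Let i2 := cimage_coord_at p.2 hN.

Let f0 : f != 0. Proof. exact: lt0r_neq0 (hF0 _). Qed.
Let betaU : beta \in unitmx. Proof. exact: sr_metric_unit i1. Qed.
Let gU : g \in unitmx. Proof. exact: sr_metric_unit i2. Qed.
Let gs : g^T = g. Proof. exact: sr_metric_sym i2. Qed.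
Let b0 : b != 0. Proof. by move: betaU; rewrite unitmxE det_mx11 unitfE. Qed.
Let betaE : beta = b%:M. Proof. exact: mx11_scalar. Qed.

Lemma gram_warped : gram p = block_mx beta 0 0 (f *: g).
Proof. by rewrite /gram /= row_mxKl row_mxKr. Qed.

Let fgU : f *: g \in unitmx.
Proof. by rewrite unitmxZ // unitfE. Qed.

Let GU : gram p \in unitmx.
Proof. by rewrite gram_warped; have [] := block_diag_inv betaU fgU. Qed.

Let giE : gi = block_mx b^-1%:M 0 0 (f^-1 *: invmx g).
Proof.
rewrite /gi gram_warped; have [_ ->] := block_diag_inv betaU fgU.
have fgK : (f *: g) *m (f^-1 *: invmx g) = 1%:M.
  by rewrite -scalemxAl -scalemxAr scalerA divff // scale1r mulmxV.
by have [_ ->] := invmx_unique fgK; rewrite betaE invmx_scalar.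
Qed.

Lemma curvature_like_base : curvature_like (RT p.2).
Proof.
apply: (curvature_like_curvature_at _ _ _ _ i2).
- exact: sr_open_image.
- exact: sr_metric_smooth.
- exact: sr_metric_sym.
- exact: sr_metric_unit.
Qed.

Lemma RT_warped : exists m l : R, forall u v w z : 'rV[R]_(1 + 3),
  RT p u v w z = f * RT p.2 (rsubmx u) (rsubmx v) (rsubmx w) (rsubmx z)
    + m * kn (inner g) (inner g) (rsubmx u) (rsubmx v) (rsubmx w) (rsubmx z)
    + l * kn (fun u v => lsubmx u 0 0 * lsubmx v 0 0)
        (fun u v => inner g (rsubmx u) (rsubmx v)) u v w z.
Proof.
have := @curvature_warped R 3 (cimage (chart_of (index_at p.1)))
  (cimage (chart_of (index_at p.2))) (metric (index_at p.1))
  (F \o Defs.cpoint (chart_of (index_at p.1))) (metric (index_at p.2)) _ _ _ _ _ _ _ _ _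
  (coord_at p).
have lE : lsubmx (coord_at p) = coord_at p.1 by rewrite /coord_at /= row_mxKl.
have rE : rsubmx (coord_at p) = coord_at p.2 by rewrite /coord_at /= row_mxKr.
case=> [||||||t _|||||m [l E]]; last first.
  exists m, l => u v w z; apply: (etrans (E u v w z)).
  by rewrite lE rE.
- by rewrite rE; exact: i2.
- by rewrite lE; exact: i1.
- exact: sr_metric_unit.
- exact: sr_metric_sym.
- exact: lt0r_neq0 (hF0 _).
- exact: sr_metric_unit.
- exact: sr_metric_smooth.
- exact: hF.
- exact: sr_metric_smooth.
- exact: sr_open_image.
- exact: sr_open_image.
Qed.

Lemma RT_base : exists s3 : 'M[R]_3, [/\ s3^T = s3, \tr (s3 *m invmx g) = 0,
  ST p.2 = inner (s3 + (kappa p.2 / 3) *: g) &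
  RT p.2 = kn (inner g) (inner s3) + (kappa p.2 / 12) *: kn (inner g) (inner g)].
Proof.
have [] := ricci_decomposition3 gU gs curvature_like_base.
rewrite -ST_ricci //; set P := tensor2_mx (ST p.2) => STE.
rewrite -(kappa_mx gU STE); move: STE; set s3 := P - _ => STE ss trs RTE.
by exists s3; split => //; rewrite /s3 subrK.
Qed.

Let RR (s3 : 'M[R]_3) (m l : R) : tensor4 R (1 + 3) :=
  let s : 'M[R]_(1 + 3) := block_mx 0 0 0 s3 in
  kn (inner H) (inner s) + m *: kn (inner H) (inner H)
  + l *: kn (inner T) (inner H).

Let TE (u v : 'rV[R]_(1 + 3)) : inner T u v = lsubmx u 0 0 * lsubmx v 0 0.
Proof. by rewrite inner_block_diag inner11 inner_mx0 mxE mul1r addr0. Qed.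

Let HE (u v : 'rV[R]_(1 + 3)) : inner H u v = f * inner g (rsubmx u) (rsubmx v).
Proof. by rewrite inner_block_diag inner_mx0 add0r inner_mxZ. Qed.

Let sE s3 (u v : 'rV[R]_(1 + 3)) :
  inner (block_mx 0 0 0 s3 : 'M[R]_(1 + 3)) u v = inner s3 (rsubmx u) (rsubmx v).
Proof. by rewrite inner_block_diag inner_mx0 add0r. Qed.

Lemma RT_warped_kn s3 :
  RT p.2 = kn (inner g) (inner s3) + (kappa p.2 / 12) *: kn (inner g) (inner g) ->
  exists m l : R, RT p = RR s3 m l.
Proof.
move=> RTE; have [m [l E]] := RT_warped.
(* [f] times [g ^ s3] is exactly [H ^ s], whereas [H ^ H] and [T ^ H] carry [f ^+ 2] and [f], hence
   the divisions. *)
exists ((f * (kappa p.2 / 12) + m) / f ^+ 2), (l / f).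
apply/funext => u; apply/funext => v; apply/funext => w; apply/funext => z.
rewrite E RTE /RR !(tensor4D, tensor4Z) /kn !TE !HE !sE.
inner_generalize.
by field.
Qed.

Let blockM (A A' : 'M[R]_1) (D D' : 'M[R]_3) :
  (block_mx A 0 0 D : 'M[R]_(1 + 3)) *m (block_mx A' 0 0 D' : 'M[R]_(1 + 3))
    = (block_mx (A *m A' : 'M[R]_1) 0 0 (D *m D' : 'M[R]_3) : 'M[R]_(1 + 3)).
Proof. by rewrite mulmx_block !mulmx0 !mul0mx !addr0 !add0r. Qed.

Let HgD (D : 'M[R]_3) : (f *: g) *m (f^-1 *: invmx g) *m D = D.
Proof.
by rewrite -scalemxAl -scalemxAr scalerA divff // scale1r mulmxV // mul1mx.
Qed.

Let DgH (D : 'M[R]_3) : D *m (f^-1 *: invmx g) *m (f *: g) = D.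
Proof.
by rewrite -!scalemxAr -scalemxAl scalerA divff // scale1r mulmxKV.
Qed.

Section Form.
Context (s3 : 'M[R]_3) (m l : R).
Hypotheses (ss3 : s3^T = s3) (trs3 : \tr (s3 *m invmx g) = 0).
Hypothesis RTE : RT p = RR s3 m l.
Let s : 'M[R]_(1 + 3) := block_mx 0 0 0 s3.
Let S := s + (4 * m + l / b) *: H + (3 * l) *: T.
Let C : tensor4 R (1 + 3) := 2^-1 *: kn (inner (H - b *: T)) (inner s).

Let gE : gram p = b *: T + H.
Proof.
rewrite gram_warped /T /H scale_block_mx !scaler0 add_block_mx !add0r !addr0.
by rewrite scale_scalar_mx mulr1 -betaE.
Qed.

Let sH : H^T = H.
Proof. by rewrite /H tr_block_mx !trmx0 linearZ /= gs. Qed.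
Let sT : T^T = T.
Proof. by rewrite /T tr_block_mx !trmx0 trmx1. Qed.
Let ss : s^T = s.
Proof. by rewrite /s tr_block_mx !trmx0 ss3. Qed.
Let HgH : H *m gi *m H = H.
Proof. by rewrite giE /H !blockM !mul0mx HgD. Qed.
Let Hgs : H *m gi *m s = s.
Proof. by rewrite giE /H /s !blockM !mul0mx HgD. Qed.
Let sgH : s *m gi *m H = s.
Proof. by rewrite giE /H /s !blockM !mul0mx DgH. Qed.
Let TgT : T *m gi *m T = b^-1 *: T.
Proof.
rewrite giE /T !blockM !mul0mx mul1mx mulmx1 scale_block_mx !scaler0.
by rewrite scale_scalar_mx mulr1.
Qed.
Let TgH : T *m gi *m H = 0.
Proof. by rewrite giE /H /T !blockM !mul0mx !mulmx0 block_mx0. Qed.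
Let HgT : H *m gi *m T = 0.
Proof. by rewrite giE /H /T !blockM !mul0mx !mulmx0 block_mx0. Qed.
Let Tgs : T *m gi *m s = 0.
Proof. by rewrite giE /s /T !blockM !mul0mx !mulmx0 block_mx0. Qed.
Let sgT : s *m gi *m T = 0.
Proof. by rewrite giE /s /T !blockM !mul0mx !mulmx0 block_mx0. Qed.
Let trH : \tr (H *m gi) = 3.
Proof.
rewrite giE /H blockM mul0mx mxtrace_block mxtrace0 add0r.
by rewrite -scalemxAl -scalemxAr scalerA divff // scale1r mulmxV // mxtrace1.
Qed.
Let trT : \tr (T *m gi) = b^-1.
Proof. by rewrite giE /T blockM mul0mx mxtrace_block mxtrace0 addr0 mul1mx mxtrace_scalar. Qed.
Let trs : \tr (s *m gi) = 0.
Proof.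
by rewrite giE /s blockM mul0mx mxtrace_block mxtrace0 add0r -scalemxAr linearZ /= trs3 mulr0.
Qed.
Let sJ : (H - b *: T)^T = H - b *: T.
Proof. by rewrite linearB linearZ /= sH sT. Qed.
Let sS : S^T = S.
Proof. by rewrite /S !linearD !linearZ /= sH sT ss. Qed.

Let dim1 : (1 + 3)%:R - 1 = 3 :> R. Proof. by rewrite natrD; ring. Qed.
Let dim2 : (1 + 3)%:R - 2 = 2 :> R. Proof. by rewrite natrD; ring. Qed.

Let STE : ST p = inner S.
Proof.
rewrite ST_ricci // RTE.
exact: (ricci_warped m l GU b0 HgH Hgs sgH TgH HgT trH trT trs).
Qed.

Let kE : kappa p = 12 * m + 6 * (l / b).
Proof. by rewrite (kappa_mx GU STE); exact: (trace_warped m l b0 trH trT trs). Qed.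

Let CE : CT p = C.
Proof.
rewrite /C -(weyl_warped s m l b0 gE TE) /CT STE RTE kE /GT.
by rewrite dim2 dim1.
Qed.

Let q3 := s3 *m invmx g *m s3.
Let qE : s *m gi *m s = block_mx 0 0 0 (f^-1 *: q3).
Proof. by rewrite giE /s !blockM !mul0mx /q3 -scalemxAr -scalemxAl. Qed.

Lemma dot_RT : dot (gram p) (RT p) (RT p) - Q (ST p) (RT p)
  = (- 2 * (l / b)) *: Q (gT p) (CT p).
Proof.
(* The square of [s] is [q3 / f], so its product with [H] is [g ^ q3], while [H ^ H] is [f ^+ 2]
   times [g ^ g]; this gives [rho]. *)
rewrite STE CE RTE; apply: (dot_R_R m l GU b0 gE sH ss sT TE HgH Hgs sgH TgT TgH HgT Tgs sgT
   (rho := \tr (q3 *m invmx g) / 4 / f ^+ 2)).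
rewrite qE; have := tracefree_square3 gU gs ss3 trs3; rewrite -/q3 => q3E.
apply/funext => u; apply/funext => v; apply/funext => w; apply/funext => z.
have := congr1 (fun h : tensor4 R 3 => h (rsubmx u) (rsubmx v) (rsubmx w) (rsubmx z)) q3E.
rewrite /= !(tensor4D, tensor4Z) /kn !HE !sE !inner_mxZ.
move: (\tr _); inner_generalize => k E.
by apply: (etrans _ (etrans E _)); field.
Qed.

Lemma dot_CT_RT : dot (gram p) (CT p) (RT p) + dot (gram p) (RT p) (CT p)
  = Q (ST p) (CT p) + (- 2 * (l / b)) *: Q (gT p) (CT p) + dot (gram p) (CT p) (CT p)
    - 4^-1 *: Q (gT p) (kn (ST p) (ST p) - kappa p *: kn (gT p) (ST p)
                        + kn (gT p) (S2T p)).
Proof.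
(* For n = 4 the factor 1/(n-2) is one half, and the scalar coefficient 1/6 becomes 1/12 because
   [GT] is half of [g ^ g]. *)
pose W : tensor4 R (1 + 3) := 2^-1 *: kn (inner (gram p)) (inner S)
  - (kappa p / 12) *: kn (inner (gram p)) (inner (gram p)).
have Gs : (gram p)^T = gram p by rewrite gE linearD linearZ /= sH sT.
have RW : RT p = CT p + W.
  apply/funext => u; apply/funext => v; apply/funext => w; apply/funext => z.
  rewrite /W /CT STE /GT !(tensor4D, tensor4N, tensor4Z) dim2 dim1.
  rewrite /gT; move: (RT p u v w z) (kn _ _ u v w z) (kn _ _ u v w z) => x1 x2 x3.
  by field.
have cC : curvature_like (CT p).
  by rewrite CE; apply: curvature_likeZ; exact: (curvature_like_kn sJ ss).
have cW : curvature_like W.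
  rewrite /W -scaleNr; apply: curvature_likeD; apply: curvature_likeZ;
  exact: curvature_like_kn.
have WW := dot_ricci_part GU Gs sS (kappa p / 12); cbv zeta in WW; rewrite -/W in WW.
have RR' := dot_RT; rewrite RW in RR'.
have k12 : 12 * (kappa p / 12) = kappa p by field.
rewrite -/gi k12 in WW.
have S2E := S2T_mx GU STE; rewrite -/gi in S2E; rewrite -S2E -STE in WW.
by rewrite RW; exact: dot_add_mixed cC cW WW RR'.
Qed.

(** Used in contrapositive form: a nonzero Weyl tensor at [p] forces N to be non-Einstein at the
    point below. *)
Lemma CT_eq0 : s3 = 0 -> CT p = 0.
Proof.
move=> s30; rewrite CE /C /s s30 block_mx0.
apply/funext => u; apply/funext => v; apply/funext => w; apply/funext => z.
by rewrite tensor4Z /kn !inner_mx0 !mulr0 !addr0 !subr0 mulr0.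
Qed.

Lemma dot_CT_CT (a c : R) (v : 'rV[R]_3) : s3 = a *: g + c *: (v^T *m v) ->
  dot (gram p) (CT p) (CT p) = (- (a / f / 2)) *: Q (gT p) (CT p).
Proof.
move=> s3E; rewrite CE.
apply: (dot_C_C GU b0 gE sH ss sT TE HgH Hgs sgH TgT TgH HgT Tgs sgT
  (al := a / f) (c := c) (V := block_mx 0 0 0 (v^T *m v))
  (v := fun u : 'rV[R]_(1 + 3) => (rsubmx u *m v^T) 0 0)).
- move=> u w; rewrite sE /inner mulmxA -mulmxA mxE big_ord1; congr (_ * _).
  by rewrite -[v *m _]trmxK trmx_mul trmxK [in LHS]mxE.
- rewrite /s /H s3E !scale_block_mx !scaler0 add_block_mx !addr0 scalerA.
  by rewrite divfK.
rewrite qE /H /s !scale_block_mx !scaler0 opp_block_mx !oppr0 add_block_mx !addr0.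
congr block_mx; rewrite /q3.
pose k := (v *m invmx g *m v^T) 0 0.
have vgv : v *m invmx g *m v^T = k%:M by rewrite [LHS]mx11_scalar.
have trv : \tr (v^T *m v *m invmx g) = k.
  by rewrite -mulmxA mxtrace_mulC vgv mxtrace_scalar.
(* Trace-freeness fixes [c * k], where [k] is the squared length of the covector [v]. Nothing is
   divided by [k], so a null [v] is covered too; then [a = 0]. *)
have trE : a * 3 + c * k = 0.
  rewrite -trs3 s3E mulmxDl -!scalemxAl linearD !linearZ /=.
  by rewrite mulmxV // mxtrace1 trv.
have ak : c * k = - (3 * a).
  by rewrite -[LHS](addKr (a * 3)) trE addr0 mulrC.
set V := v^T *m v in s3E *.
have VgV : V *m invmx g *m V = k *: V.
  transitivity (v^T *m (v *m invmx g *m v^T) *m v); first by rewrite !mulmxA.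
  by rewrite vgv mul_mx_scalar -scalemxAl.
have -> : s3 *m invmx g *m s3 = (2 * a ^+ 2) *: g - a *: s3.
  rewrite s3E !mulmxDl !mulmxDr -!(scalemxAl, scalemxAr) VgV.
  rewrite !mulmxKV // mulmxV // mul1mx.
  generalize V g => V' g'; apply/matrixP => i j; rewrite !mxE.
  have -> : c * (c * (k * V' i j)) = - 3 * a * c * V' i j.
    by rewrite [c * (k * _)]mulrA ak; ring.
  by ring.
rewrite scalerBr !scalerA [f^-1 * a]mulrC; congr (_ *: _ - _).
by field.
Qed.

End Form.
End WarpedPoint.

Lemma warped_identities (R : realType) (B : semiriem R 1) (N : semiriem R 3)
    (F : B -> R) (hB : semiriemannian B) (hN : semiriemannian N)
    (hF : smooth_fun B F) (hF0 : forall t : B, 0 < F t) :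
  let M := warped B N F in
  let n : R := 4 in
  forall p : M, exists L : R,
    let g := gT p in let S := ST p in let S2 := S2T p in
    let RR := RT p in let C := CT p in
    dot (gram p) RR RR - Q S RR = L *: Q g C /\
    dot (gram p) C RR + dot (gram p) RR C
      = Q S C + L *: Q g C + dot (gram p) C C
        - ((n - 2) ^+ 2)^-1 *:
          Q g (((n - 2) / 2) *: kn S S - kappa p *: kn g S + kn g S2).
Proof.
cbv zeta => p.
have n2 : 4 - 2 = 2 :> R by ring.
have -> : ((4 - 2) ^+ 2)^-1 = 4^-1 :> R by rewrite n2; congr (_^-1); ring.
have -> : (4 - 2) / 2 = 1 :> R by rewrite n2 divff // pnatr_eq0.
have [s3 [ss3 trs3 _ RTE]] := RT_base hN p.
have [m [l RTE']] := RT_warped_kn hB hN hF hF0 RTE.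
exists (- 2 * (l / gram p.1 0 0)); split.
  exact: (dot_RT hB hN hF0 ss3 trs3 RTE').
rewrite scale1r; exact: (dot_CT_RT hB hN hF0 ss3 trs3 RTE').
Qed.

(** The rank condition speaks only of the points of N in [U_S]; [CT_eq0] shows that every point of
    [U_C] lies above such a point. *)
Lemma warped_quasi_einstein (R : realType) (B : semiriem R 1) (N : semiriem R 3)
    (F : B -> R) (hB : semiriemannian B) (hN : semiriemannian N)
    (hF : smooth_fun B F) (hF0 : forall t : B, 0 < F t) (p : warped B N F) :
  quasi_einstein N -> U_C (warped B N F) p ->
  exists L : R, dot (gram p) (CT p) (CT p) = L *: Q (gT p) (CT p).
Proof.
move=> [_ [alpha rk]] UCp.
have [s3 [ss3 trs3 STE RTE]] := RT_base hN p.
have [m [l RTE']] := RT_warped_kn hB hN hF hF0 RTE.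
have s3E (c : R) i j :
    (ST p.2 - c *: gT p.2) (delta_mx 0 i) (delta_mx 0 j)
    = s3 i j + (kappa p.2 / 3 - c) * gram p.2 i j.
  rewrite STE.
  rewrite -[LHS]/(inner (s3 + (kappa p.2 / 3) *: gram p.2) (delta_mx 0 i) (delta_mx 0 j)
     - c * inner (gram p.2) (delta_mx 0 i) (delta_mx 0 j)).
  by rewrite !inner_delta !mxE; ring.
have /rk : U_S N p.2.
  move=> E; apply: UCp; apply: (CT_eq0 hB hN hF0 trs3 RTE').
  apply/matrixP => i j; rewrite mxE.
  have := s3E (kappa p.2 / 3) i j; rewrite E subrr => /esym.
  by rewrite subrr mul0r addr0.
set E := tensor2_mx _ => rkE.
have EE : E = s3 + (kappa p.2 / 3 - alpha p.2) *: gram p.2.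
  by apply/matrixP => i j; rewrite [LHS]mxE s3E !mxE.
have [|c [v Ev]] := symmetric_rank1 _ rkE.
  rewrite EE linearD linearZ /= ss3; congr (_ + _ *: _).
  apply: (sr_metric_sym hN); exact: cimage_coord_at.
(* [s3] is the rank-one tensor [ST - alpha g] of N plus [alpha - kappa / 3] times [g]; dividing by
   the value of [F] gives the coefficient with respect to [H]. *)
exists (- ((alpha p.2 - kappa p.2 / 3)
  / F (Defs.cpoint (chart_of (index_at p.1)) (coord_at p.1)) / 2)).
apply: (dot_CT_CT hB hN hF0 ss3 trs3 RTE' (c := c) (v := v)).
rewrite -Ev EE addrCA -scalerDl [X in X *: _](_ : _ = 0); last by ring.
by rewrite scale0r addr0.
Qed.

Theorem theorem4p1 (R : realType) (B : semiriem R 1) (N : semiriem R 3)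
    (F : B -> R) (hB : semiriemannian B) (hN : semiriemannian N)
    (hB1 : unit_metric B) (hF : smooth_fun B F) (hF0 : forall t : B, 0 < F t)
    (hNc : ~ constant_curvature N) :
  let M := warped B N F in
  let n : R := 4 in
  exists L : M -> R,
    (forall p : M, U_C M p ->
       let g := gT p in let S := ST p in let S2 := S2T p in
       let RR := RT p in let C := CT p in
       dot (gram p) RR RR - Q S RR = L p *: Q g C /\
       dot (gram p) C RR + dot (gram p) RR C
         = Q S C + L p *: Q g C + dot (gram p) C C
           - ((n - 2) ^+ 2)^-1 *:
             Q g (((n - 2) / 2) *: kn S S - kappa p *: kn g S + kn g S2)) /\
    (quasi_einstein N ->
     exists LC : M -> R,
       forall p : M, U_S M p -> U_C M p ->
       let g := gT p in let S := ST p in let S2 := S2T p in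
       let RR := RT p in let C := CT p in
       dot (gram p) C C = LC p *: Q g C /\
       dot (gram p) C RR + dot (gram p) RR C
         = Q S C + (L p + LC p) *: Q g C
           - ((n - 2) ^+ 2)^-1 *:
             Q g (((n - 2) / 2) *: kn S S - kappa p *: kn g S + kn g S2)).
Proof.
cbv zeta.
(* The function [L] is assembled from the constants found at the single points. *)
have [L LP] := choice (warped_identities hB hN hF hF0); cbv zeta in LP.
exists L; split=> [p _|qN]; first exact: LP.
have CCE (p : warped B N F) : exists K : R, U_C (warped B N F) p ->
    dot (gram p) (CT p) (CT p) = K *: Q (gT p) (CT p).
  (* Choice needs a value at every point; outside [U_C] the value 0 is a placeholder. *)
  have [UCp|nUCp] := pselect (U_C (warped B N F) p); last by exists 0.
  by have [K KP] := warped_quasi_einstein hB hN hF hF0 qN UCp; exists K.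
have [LC LCP] := choice CCE.
exists LC => p _ UCp; split; first exact: LCP.
move: (proj2 (LP p)) (LCP p UCp).
generalize (dot (gram p) (CT p) (CT p)) (dot (gram p) (CT p) (RT p))
  (dot (gram p) (RT p) (CT p)) (Q (ST p) (CT p)) (Q (gT p) (CT p)).
move=> CC CR RC QSC QgC; set K := Q (gT p) (_ + _).
move: K => K E1 E2.
apply/funext => X1; apply/funext => X2; apply/funext => X3; apply/funext => X4.
apply/funext => X; apply/funext => Y.
have {}E1 := congr1 (fun h : tensor6 R (1 + 3) => h X1 X2 X3 X4 X Y) E1.
have {}E2 := congr1 (fun h : tensor6 R (1 + 3) => h X1 X2 X3 X4 X Y) E2.
move: E1 E2; rewrite /= !(tensor6D, tensor6N, tensor6Z) => -> ->.
by ring.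
Qed.
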